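(* Let $\alpha<0$. Let $K$ be a probability measure on $[1/2,1)$ with $K\ne\delta_{1/2}$, let $Y$ be a random variable with law $K$, and let $c\in\mathbb{R}$ be such that $\mathbb{E}[\log(1-Y)]+c<0<\mathbb{E}[\log Y]+c$. Consider the $\alpha$-self-similar fragmentation process $\mathcal{X}$ defined in the context. Then, for any $a>0$, there exists a finite random time $\sigma$ such that, almost surely, there are infinitely many individuals of $\mathcal{X}(\sigma)$ in the compact set $[1,1+a]$; that is, infinitely many $u\in\mathcal{U}$ for which $S_u(\sigma)$ is defined, $a_u\le S_u(\sigma)<b_u$ and $\exp(\xi_u(S_u(\sigma)))\in[1,1+a]$.
   Context: Tree. Let $\mathcal{U}=\bigcup_{n\ge0}\{L,R\}^n$ (with $\{L,R\}^0=\{\varnothing\}$) be the binary tree of finite words and $\mathcal{V}=\{L,R\}^{\mathbb{N}}$ the set of rays (infinite words). For $u,u'\in\mathcal{U}$ write $u\preceq u'$ if $u$ is a prefix of $u'$, and $u\prec u'$ if moreover $u\ne u'$; for $u\in\mathcal{U}$, $v\in\mathcal{V}$ write $u\prec v$ if $u$ is a prefix of $v$. Homogeneous model. To each $u\in\mathcal{U}$ assign, all independently, a lifetime $T_u$ with the exponential distribution of rate $1$ and a random variable $Y_u$ with law $K$. Fix $x\in\mathbb{R}$, put $\zeta_\varnothing=x$ and recursively $$\zeta_{uL}=\zeta_u+\log(1-Y_u)+cT_u,\qquad \zeta_{uR}=\zeta_u+\log(Y_u)+cT_u.$$ Let $a_u=\sum_{u'\prec u}T_{u'}$ and $b_u=a_u+T_u$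 be the birth and death times of $u$, and let $\xi_u(t)=\zeta_u+c(t-a_u)$ for $a_u\le t<b_u$. For $v\in\mathcal{V}$ let $\xi_v(t)=\xi_u(t)$, where $u$ is the unique individual with $u\prec v$ and $a_u\le t<b_u$. Self-similar model. For $v\in\mathcal{V}$ let $T_v(s)=\int_0^s\mathrm{e}^{-\alpha\xi_v(r)}\,\mathrm{d}r$ and let $S_v$ be its inverse. If $u\in\mathcal{U}$ is such that for some $v\in\mathcal{V}$ with $u\prec v$ one has $a_u\le S_v(t)<b_u$, define $S_u(t):=S_v(t)$ (this does not depend on the choice of $v$). The $\alpha$-self-similar fragmentation process is $$\mathcal{X}(t)=\sum_{u\in\mathcal{U}}\delta_{\exp(\xi_u(S_u(t)))}\mathbf{1}_{\{a_u\le S_u(t)<b_u\}},\qquad t\ge0,$$ the sum being over only those $u$ for which $S_u(t)$ is defined. *)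

(* Defs.v *)
From HB Require Import structures.
From mathcomp Require Import all_boot all_order all_algebra.
From mathcomp Require Import all_classical all_reals all_analysis.

Set Implicit Arguments.
Unset Strict Implicit.
Unset Printing Implicit Defensive.

Import Order.TTheory GRing.Theory Num.Theory.
Import numFieldNormedType.Exports.

Local Open Scope classical_set_scope.
Local Open Scope ring_scope.

(* [Lft] and [Rgt] are the letters L and R of the binary tree. *)
Notation Lft := false.
Notation Rgt := true.
Definition word := seq bool.
Definition ray := nat -> bool.

Definition ray_prefix (u : word) (v : ray) : Prop := mkseq v (size u) = u.

(* Mutual independence of a possibly infinite family of real random variables:
   the product rule over every finite subfamily. *)
Definition mutually_independent (d : measure_display) (Omega : measurableType d)
    (R : realType) (P : probability Omega R) (I : eqType)
    (X : I -> {RV P >-> R}) : Prop :=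
  forall (s : seq I) (A : I -> set R), uniq s ->
    (forall i, measurable (A i)) ->
    P (\big[setI/setT]_(i <- s) (X i @^-1` A i)) =
    (\prod_(i <- s) P (X i @^-1` A i))%E.

(* Equality of laws on R. Equality of the underlying set functions would be
   too fine, since measures are total functions whose values on nonmeasurable
   sets carry no meaning. *)
Definition same_law (R : realType) (mu nu : set (measurableTypeR R) -> \bar R) :
    Prop :=
  forall A : set (measurableTypeR R), measurable A -> mu A = nu A.

(* The deterministic construction of the fragmentation process, for one
   realization [T], [Y] of the lifetimes and of the dislocation variables. *)
Section Fragmentation.
Variables (R : realType) (alpha c x : R) (T Y : word -> R).

Definition child_factor (l : bool) (y : R) : R :=
  if l is Rgt then y else 1 - y.

(* The proper prefixes of [u] are the [take i u] with [i < size u]. *)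
Definition birth (u : word) : R := \sum_(i < size u) T (take i u).

Definition death (u : word) : R := birth u + T u.

(* Unfolding of the recursion along the ancestors of [u]; the recursion itself
   is [zeta_nil], [zeta_Lft] and [zeta_Rgt] below. *)
Definition zeta (u : word) : R :=
  x + \sum_(i < size u)
        (ln (child_factor (nth Lft u i) (Y (take i u))) + c * T (take i u)).

Lemma zeta_nil : zeta [::] = x.
Proof. by rewrite /zeta big_ord0 addr0. Qed.

Let zeta_rcons u l :
  zeta (rcons u l) = zeta u + ln (child_factor l (Y u)) + c * T u.
Proof.
rewrite /zeta size_rcons big_ord_recr/= -cats1 nth_cat ltnn subnn/=.
rewrite take_size_cat// !addrA; congr (_ + _ + _ + _).
by apply: eq_bigr => i _; rewrite nth_cat ltn_ord takel_cat// ltnW.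
Qed.

Lemma zeta_Lft u : zeta (rcons u Lft) = zeta u + ln (1 - Y u) + c * T u.
Proof. exact: zeta_rcons. Qed.

Lemma zeta_Rgt u : zeta (rcons u Rgt) = zeta u + ln (Y u) + c * T u.
Proof. exact: zeta_rcons. Qed.

Definition xi (u : word) (t : R) : R := zeta u + c * (t - birth u).

(* The default value 0 is only met when no individual on the ray [v] is alive
   at time [t], i.e. on a null event. *)
Definition xi_ray (v : ray) (t : R) : R :=
  xget 0 [set y | exists u : word,
    [/\ ray_prefix u v, birth u <= t < death u & y = xi u t]].

Definition T_ray (v : ray) (s : R) : \bar R :=
  (\int[@lebesgue_measure R]_(r in `[0%R, s]) (expR (- alpha * xi_ray v r))%:E)%E.

(* [T_ray v] need not be onto [0, +oo[; its inverse takes the value +oo outside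
   of its range. *)
Definition S_ray (v : ray) (t : R) : \bar R :=
  xget +oo%E [set s%:E%E | s in [set s : R | 0 <= s /\ T_ray v s = t%:E%E]].

Definition S_defined (u : word) (t : R) : Prop :=
  exists v : ray, ray_prefix u v /\
    ((birth u)%:E <= S_ray v t < (death u)%:E)%E.

(* Meaningful only when [S_defined u t]; the value +oo is then never taken. *)
Definition S_ind (u : word) (t : R) : \bar R :=
  xget +oo%E [set s | exists v : ray, [/\ ray_prefix u v,
    ((birth u)%:E <= S_ray v t < (death u)%:E)%E & s = S_ray v t]].

(* The individuals of the self-similar fragmentation process at time [t] whose
   size belongs to [B], i.e. the atoms, with multiplicity, of the restriction
   to [B] of the point measure X(t). *)
Definition fragments_in (t : R) (B : set R) : set word :=
  [set u | [/\ S_defined u t,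
    ((birth u)%:E <= S_ind u t < (death u)%:E)%E &
    B (expR (xi u (fine (S_ind u t))))]].

End Fragmentation.

(* Main.v *)
Require Import Defs.
From HB Require Import structures.
From mathcomp Require Import all_boot all_order all_algebra.
From mathcomp Require Import all_classical all_reals all_analysis.
From mathcomp Require Import measurable_realfun.
From mathcomp Require Import ring lra.

(** Write [b = - alpha > 0].  Since the mean of [ln Y] is at most 0, the drift
    hypothesis on [ln Y] forces [c > 0]: between dislocations logarithmic sizes
    grow linearly, and they jump down at dislocations.

    Along the ray that always takes the smaller piece, [xi] drifts to minus
    infinity so fast that its self-similar clock, the integral of [e^(b xi)],
    stays bounded: infinitely many individuals, of size tending to 0, are born
    before one finite time.  From each of these tiny individuals, follow the
    ray that always takes the larger piece.  There [xi] drifts to plus infinity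
    and crosses 0 continuously, upwards.  The self-similar time needed to climb
    from size [e^(-h)] to size 1 is tight uniformly in [h], because small sizes
    contribute little to the integral of [e^(b xi)].  So infinitely many
    branches cross size 1 within one bounded window of time, and each stays in
    [[1, 1 + a]] for a time bounded below.  By the pigeonhole principle some
    point of a fine grid of times is a time at which infinitely many branches
    are in [[1, 1 + a]], and [sigma] is the first such point in an enumeration
    of all the grids.

    The quantitative ingredients are the following.
    - [small_exponent] and [weight_summable]: a random walk with negative mean
      increments has a negative exponential moment rate, so the sum of
      [e^(theta S)] along the walk is almost surely finite.  With the small
      pieces this gives [ae_spine]; with the large pieces, for the reflected
      walk, it gives [ae_crossing].
    - [integral_growth_sum]: [e^(b xi)] stopped at the first passage at 0 is
      bounded by 1, and its expected increase is at least a fixed multiple of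
      the expected elapsed self-similar time, because
      [b c - E(1 - Y^b) >= b (c + E(ln Y)) > 0].  Hence this elapsed time has a
      mean that is bounded independently of the starting point.
    - [integral_overshoot_sum]: by lack of memory of the exponential law, the
      individual that crosses size 1 is likely to live a little longer.
    - [miss_bound] and [ae_infinitely_many_good]: each branch misses the window with
      small probability, uniformly in the branch.  If branches from some rank on
      all missed it, this event would have at most the probability of a single
      miss; so almost surely infinitely many branches do not miss it.
    - [fragment_in]: the pathwise criterion, in terms of the rescaled clock
      [clock], for a word to be a fragment of size in [[1, 1 + a]]. *)

Import Order.TTheory GRing.Theory Num.Theory.
Import numFieldNormedType.Exports.

Set Implicit Arguments.
Unset Strict Implicit.
Unset Printing Implicit Defensive.

Local Open Scope classical_set_scope.
Local Open Scope ring_scope.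

(** * Independence of one variable from all the others *)

Section independence.
Context (R : realType) (d : measure_display) (Omega : measurableType d).
Context (P : probability Omega R) (dE : measure_display) (E : measurableType dE).
Context (I : choiceType) (X : I -> Omega -> E).
Hypothesis mX : forall i, measurable_fun [set: Omega] (X i).
Hypothesis indepX : forall (s : seq I) (A : I -> set E), uniq s ->
  (forall i, measurable (A i)) ->
  P (\big[setI/setT]_(i <- s) (X i @^-1` A i)) =
  (\prod_(i <- s) P (X i @^-1` A i))%E.

Definition cylinders (j : I) : set (set Omega) :=
  [set B | exists s (A : I -> set E), [/\ uniq s, j \notin s,
    forall i, measurable (A i) & B = \big[setI/setT]_(i <- s) (X i @^-1` A i)]].

(** The sigma-algebra generated by all the variables except [X j], carried by a
    type, so that the closure properties of measurable functions apply to the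
    functions that do not depend on [X j]. *)
Definition without (j : I) := g_sigma_algebraType (cylinders j).

Let mpreX i (A : set E) : measurable A -> measurable (X i @^-1` A).
Proof. by move=> mA; rewrite -[X in measurable X]setTI; exact: mX. Qed.

Lemma cylinders_setI j : setI_closed (cylinders j).
Proof.
move=> _ _ [s1 [A1 [us1 js1 mA1 ->]]] [s2 [A2 [us2 js2 mA2 ->]]].
pose A' (s : seq I) A i := if i \in s then A i else [set: E].
exists (undup (s1 ++ s2)), (fun i => A' s1 A1 i `&` A' s2 A2 i); split.
- exact: undup_uniq.
- by rewrite mem_undup mem_cat negb_or js1.
- by move=> i; apply: measurableI; rewrite /A'; case: ifP.
rewrite -!bigcap_seq; apply/seteqP; split => w /=.
  move=> [h1 h2] i /=; rewrite mem_undup mem_cat /A' => _.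
  by split; case: ifPn => // ?; [exact: h1|exact: h2].
move=> h; split => i /= si.
  by have /= := h i; rewrite mem_undup mem_cat si /A' si => /(_ isT)[].
by have /= := h i; rewrite mem_undup mem_cat si orbT /A' si => /(_ isT)[].
Qed.

(** The pi-lambda theorem extends the product rule from the cylinders to the
    sigma-algebra that they generate. *)
Lemma indep_without j (A : set Omega) (B : set E) :
  <<s cylinders j >> A -> measurable B ->
  measurable A /\ P (A `&` X j @^-1` B) = (P A * P (X j @^-1` B))%E.
Proof.
move=> sA mB; have mXB : measurable (X j @^-1` B) by exact: mpreX.
have PT : P (setT : set (without j)) = 1%E by exact: (@probability_setT _ _ _ P).
move: A sA.
apply: (@dynkin_induction _ (without j) (cylinders j)
  [set A | measurable (A : set Omega) /\ P (A `&` X j @^-1` B) = (P A * P (X j @^-1` B))%E]).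
- by [].
- exact: cylinders_setI.
- split; first exact: (@measurableT _ Omega).
  by rewrite /= setTI PT mul1e.
- move=> _ [s [A [us js mA ->]]]; split.
    rewrite -bigcap_seq; apply: fin_bigcap_measurable => // i _.
    exact: mpreX.
  pose A' i := if i == j then B else A i.
  have AA' : \big[setI/setT]_(i <- s) (X i @^-1` A i) =
             \big[setI/setT]_(i <- s) (X i @^-1` A' i).
    by apply: eq_big_seq => i si; rewrite /A'; case: eqP js => // <-; rewrite si.
  have := @indepX (j :: s) A'; rewrite /= js us big_cons /A' eqxx => /(_ isT).
  rewrite -/A' big_cons eqxx setIC -AA' => -> => [|i]; last by case: ifP.
  rewrite [LHS]muleC; congr (_ * _)%E; rewrite indepX//.
  by apply: eq_big_seq => i si; rewrite /A'; case: eqP js => // <-; rewrite si.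
- move=> S mS [mS' PS]; split; first exact: measurableC.
  rewrite setIC -setDE measureD//=; last by rewrite ltey_eq fin_num_measure.
  rewrite setIC PS probability_setC//.
  rewrite muleBl ?mul1e//; exact: fin_num_measure.
- move=> F mF tF hF; split; first by apply: bigcup_measurable => n _; have [] := hF n.
  rewrite setI_bigcupl measure_bigcup//; last 2 first.
  + by move=> n _; apply: measurableI => //; have [] := hF n.
  + exact: trivIset_setIr.
  rewrite measure_bigcup//; last by move=> n _; have [] := hF n.
  transitivity (\sum_(0 <= n <oo | n \in [set: nat])
      (P (F n) * P (X j @^-1` B)))%E.
    by apply: eq_eseriesr => n _; exact: (hF n).2.
  rewrite -[X in (_ * X)%E](fineK (fin_num_measure P _ mXB)) muleC.
  rewrite -nneseriesZl//.
  by apply: eq_eseriesr => n _; rewrite muleC fineK// fin_num_measure.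
Qed.

Lemma measurable_without j i : i != j ->
  measurable_fun [set: without j] (X i : without j -> E).
Proof.
move=> ij _ A mA; rewrite setTI; apply: sub_sigma_algebra.
exists [:: i], (fun=> A); split => //; first by rewrite inE eq_sym.
by rewrite big_seq1.
Qed.

Lemma withoutW j d' (S : measurableType d') (Z : Omega -> S) :
  measurable_fun [set: without j] (Z : without j -> S) ->
  measurable_fun [set: Omega] Z.
Proof.
move=> mZ _ A mA; rewrite setTI.
have := mZ measurableT A mA; rewrite setTI => h.
by have [] := @indep_without j _ setT h measurableT.
Qed.

(** The joint law of [Z] and [X j] is the product of their laws, so [X j] can be
    integrated out first: this is conditioning on all the other variables. *)
Lemma indep_fubini j (mu : probability E R) d' (S : measurableType d')
    (Z : Omega -> S) (f : S * E -> \bar R) :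
  (forall A, measurable A -> P (X j @^-1` A) = mu A) ->
  measurable_fun [set: without j] (Z : without j -> S) ->
  measurable_fun setT f -> (forall z, 0 <= f z)%E ->
  (\int[P]_w f (Z w, X j w) = \int[P]_w \int[mu]_y f (Z w, y))%E.
Proof.
move=> lawj mZ0 mf f0; have mZ := withoutW mZ0.
pose Zf : {RV P >-> S} := HB.pack Z (isMeasurableFun.Build _ _ _ _ _ mZ).
pose ZX : {RV P >-> (S * E)%type} := HB.pack (fun w : Omega => (Z w, X j w))
   (isMeasurableFun.Build _ _ _ _ _ (measurable_fun_pair mZ (mX j))).
transitivity (\int[distribution P ZX]_z f z)%E.
  by rewrite ge0_integral_distribution.
have -> : (\int[distribution P ZX]_z f z = \int[(distribution P Zf \x mu)%E]_z f z)%E.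
  apply: eq_measure_integral => A mA _; apply/esym.
  apply: product_measure_unique => //= B C mB mC.
  have mZB : <<s cylinders j >> (Z @^-1` B).
    by have := mZ0 measurableT B mB; rewrite setTI.
  by rewrite -lawj//; have [_ <-] := indep_without mZB mC.
rewrite fubini_tonelli1// ge0_integral_distribution//.
- exact: measurable_fun_fubini_tonelli_F.
- by move=> y; apply: integral_ge0.
Qed.

End independence.

(** * Integration against a density *)

Section density.
Context d (E : measurableType d) (R : realType).
Context (mu nu : {measure set E -> \bar R}) (p : E -> R).
Hypothesis p0 : forall x, 0 <= p x.
Hypothesis mp : measurable_fun setT p.
Hypothesis nuE : forall A, measurable A -> nu A = (\int[mu]_(x in A) (p x)%:E)%E.

Import HBNNSimple.

(** Both sides are limits along an increasing sequence of simple functions,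
    for which the identity is the hypothesis on [nu]. *)
Lemma ge0_integral_density (f : E -> \bar R) :
  (forall x, 0 <= f x)%E -> measurable_fun setT f ->
  (\int[nu]_x f x = \int[mu]_x (f x * (p x)%:E))%E.
Proof.
move=> f0 mf; pose h := nnsfun_approx measurableT mf.
have hf x : EFin \o h^~ x @ \oo --> f x by apply: cvg_nnsfun_approx.
transitivity (limn (fun n => \int[nu]_x (h n x)%:E)%E).
  rewrite -monotone_convergence//.
  - by apply: eq_integral => x _; apply/esym/cvg_lim => //; exact: hf.
  - by move=> n; exact/measurable_EFinP.
  - by move=> n x _; rewrite lee_fin.
  - by move=> x _ m n mn; rewrite lee_fin; exact/lefP/nd_nnsfun_approx.
transitivity (limn (fun n => \int[mu]_x ((h n x)%:E * (p x)%:E))%E); last first.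
  rewrite -monotone_convergence//.
  - apply: eq_integral => x _; apply/cvg_lim => //.
    by apply: cvgeZr => //; exact: hf.
  - by move=> n; apply: emeasurable_funM => //; exact/measurable_EFinP.
  - by move=> n x _; apply: mule_ge0 => //; rewrite lee_fin ?p0.
  - move=> x _ m n mn; rewrite lee_wpmul2r ?lee_fin//.
    exact/lefP/nd_nnsfun_approx.
congr (limn _); apply/funext => n.
under eq_integral do rewrite fimfunE -fsumEFin//.
rewrite ge0_integral_fsum//; last 2 first.
  by move=> y; apply/measurable_EFinP; exact: measurable_funM.
  by move=> y x _; exact: nnfun_muleindic_ge0.
under [RHS]eq_integral.
  move=> x _; rewrite fimfunE -fsumEFin// ge0_mule_fsuml; last first.
    by move=> y; exact: nnfun_muleindic_ge0.
  over.
rewrite ge0_integral_fsum//; last 2 first.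
- move=> y; apply: emeasurable_funM; apply/measurable_EFinP => //.
  exact: measurable_funM.
- by move=> y x _; apply: mule_ge0; rewrite ?lee_fin//; exact: nnfun_muleindic_ge0.
apply: eq_fsbigr => y; rewrite inE => -[x0 _ <-].
have mA : measurable (h n @^-1` [set h n x0]) by [].
under eq_integral do rewrite EFinM.
under [RHS]eq_integral do rewrite EFinM -muleA.
rewrite !ge0_integralZl ?lee_fin//; last 3 first.
- by apply: emeasurable_funM; apply/measurable_EFinP.
- by move=> x _; rewrite mule_ge0 ?lee_fin.
- by apply/measurable_EFinP.
congr (_ * _)%E.
rewrite integral_indic// setIT nuE// [LHS]integral_mkcond.
apply: eq_integral => x _; rewrite patchE indicE.
by case: ifPn => _; rewrite ?mul1e ?mul0e.
Qed.

End density.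

(** * The standard exponential law *)

(** The rate must be known to be positive for [exponential_prob] to be a
    probability; fixing this proof once makes its measure structure canonical. *)
Definition exponential1 (R : realType) : probability (measurableTypeR R) R.
Proof. by refine (exponential_prob (1 : R) : probability _ _); exact: ltr01. Defined.

Section exponential_law.
Context (R : realType).
Local Notation nu := (exponential1 R).
Local Notation leb := (@lebesgue_measure R).

Lemma ge0_integral_exponential (f : R -> \bar R) :
  (forall t, 0 <= f t)%E -> measurable_fun setT f ->
  (\int[nu]_t f t = \int[leb]_t (f t * (exponential_pdf 1 t)%:E))%E.
Proof.
move=> f0 mf; apply: (@ge0_integral_density _ (measurableTypeR R) _ _ _ (exponential_pdf 1)) => //.
- by move=> t; exact: exponential_pdf_ge0.
- exact: measurable_exponential_pdf.
Qed.

Lemma exponential_mgf (l : R) : l < 1 ->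
  (\int[nu]_t (expR (l * t))%:E)%E = ((1 - l)^-1)%:E.
Proof.
move=> l1; have l1' : 0 < 1 - l by rewrite subr_gt0.
rewrite ge0_integral_exponential; last 2 first.
- by move=> t; rewrite lee_fin expR_ge0.
- apply/measurable_EFinP; apply: measurableT_comp; first exact: measurable_expR.
  exact: mulrl_measurable.
transitivity (\int[leb]_t (((1 - l)^-1)%:E * (exponential_pdf (1 - l) t)%:E))%E.
  apply: eq_integral => t _; rewrite -!EFinM; congr EFin.
  rewrite /exponential_pdf !patchE; case: ifPn => _; last by rewrite !mulr0.
  rewrite mul1r mulrA mulVf ?gt_eqF// mul1r -expRD; congr expR; ring.
rewrite ge0_integralZl ?lee_fin ?invr_ge0 ?ltW//.
- by rewrite integral_exponential_pdf// mule1.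
- by apply/measurable_EFinP; exact: measurable_exponential_pdf.
- by move=> t _; rewrite lee_fin exponential_pdf_ge0// ltW.
Qed.

Let cexpN : continuous (fun x : R => expR (- x)).
Proof.
move=> x; apply: continuous_comp; last exact: continuous_expR.
by apply: (@continuousN _ R^o); exact: cvg_id.
Qed.

Lemma exponential_tail (s : R) : 0 <= s -> nu `[s, +oo[%classic = (expR (- s))%:E.
Proof.
move=> s0; rewrite /exponential1/= /exponential_prob.
rewrite (eq_integral (fun t : measurableTypeR R => (expR (- (t : R)))%:E)); last first.
  move=> t; rewrite inE/= in_itv/= andbT => st.
  by rewrite exponential_pdfE ?(le_trans s0)// mul1r mulN1r.
rewrite (@ge0_continuous_FTC2y _ _ (fun x => - expR (- x)) s 0).
- by rewrite sub0e EFinN oppeK.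
- by move=> x _; exact: expR_ge0.
- apply: continuous_subspaceT; exact: cexpN.
- by rewrite -oppr0; apply: cvgN; exact: cvgr_expR.
- by move=> x _; exact: ex_derive.
- by apply: cvg_at_right_filter; apply: (@cvgN _ R^o); exact: cexpN.
- move=> x _; rewrite derive1N// derive1_comp// derive1N// derive1_id.
  rewrite derive1E; have /funeqP -> := @derive_expR R.
  by rewrite mulrN1 opprK.
Qed.

(** Exponential growth that is killed at the time [s] when it reaches 1. *)
Definition truncated_growth (g s t : R) : R :=
  if t < s then expR (g * (t - s)) else 0.

Lemma truncated_growth_ge0 g s t : 0 <= truncated_growth g s t.
Proof. by rewrite /truncated_growth; case: ifP => // _; exact: expR_ge0. Qed.

Lemma measurable_truncated_growth g s :
  measurable_fun setT (truncated_growth g s).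
Proof.
apply: measurable_fun_ifT => //.
- exact: measurable_fun_ltr.
- apply: measurableT_comp; first exact: measurable_expR.
  by apply: measurable_funM => //; apply: measurable_funB.
Qed.

(** Only the relation satisfied by the integral matters: dividing by [1 - g]
    would exclude [g = 1]. *)
Lemma exponential_truncated (g s : R) : 0 <= s ->
  exists I : R, (\int[nu]_t (truncated_growth g s t)%:E)%E = I%:E /\
   (1 - g) * I = expR (- (g * s)) - expR (- s).
Proof.
rewrite le_eqVlt => /predU1P[<-|s0].
  exists 0; rewrite !mulr0 !oppr0 subrr; split => //.
  rewrite ge0_integral_exponential.
  - rewrite integral0_eq// => t _; rewrite /truncated_growth.
    case: ltP => // t0; last by rewrite mul0e.
    by rewrite lt0_exponential_pdf// mule0.
  - by move=> t; rewrite lee_fin truncated_growth_ge0.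
  - by apply/measurable_EFinP; exact: measurable_truncated_growth.
pose h t := expR ((g - 1) * t - g * s).
have ch : continuous h.
  move=> t; apply: continuous_comp; last exact: continuous_expR.
  apply: (@continuousB _ R^o); last exact: cst_continuous.
  by apply: (@continuousM _ R^o); [exact: cst_continuous|exact: cvg_id].
have E : (\int[nu]_t (truncated_growth g s t)%:E =
    \int[leb]_(t in `[0%R, s]) (h t)%:E)%E.
  rewrite ge0_integral_exponential; last 2 first.
  - by move=> t; rewrite lee_fin truncated_growth_ge0.
  - by apply/measurable_EFinP; exact: measurable_truncated_growth.
  rewrite -integral_itv_bndo_bndc; last first.
    apply/measurable_EFinP; apply: measurable_funTS.
    exact: continuous_measurable_fun.
  rewrite [RHS]integral_mkcond; apply: eq_integral => t _.
  rewrite /truncated_growth patchE mem_setE in_itv/=.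
  case: (ltP t s) => ts; rewrite ?andbF ?mul0e//.
  rewrite andbT; case: (leP 0 t) => t0; last by rewrite lt0_exponential_pdf// mule0.
  rewrite exponential_pdfE// mul1r -EFinM -expRD; congr (expR _)%:E.
  rewrite /h; ring.
have ih : leb.-integrable `[0, s] (EFin \o h).
  apply: continuous_compact_integrable; first exact: segment_compact.
  by apply: continuous_subspaceT.
exists (\int[leb]_(t in `[0%R, s]) h t)%R; rewrite E; split.
  by rewrite fineK//; exact: integrable_fin_num.
suff : ((1 - g)%:E * \int[leb]_(t in `[0%R, s]) (h t)%:E =
  (expR (- (g * s)) - expR (- s))%:E)%E.
  rewrite -[X in (_ * X)%E]fineK; last exact: integrable_fin_num.
  by rewrite -EFinM => -[].
rewrite -integralZl//.
under eq_integral do rewrite -EFinM.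
rewrite (@continuous_FTC2 _ _ (fun t => - h t)) //.
- rewrite -EFinB; congr EFin; rewrite /h.
  rewrite opprK addrC mulr0 sub0r; congr (_ - expR _); ring.
- apply: continuous_subspaceT => x; apply: (@continuousM _ R^o (fun=> 1 - g) h); last exact: ch.
  exact: cst_continuous.
- split.
  + by move=> x _; rewrite /h; exact: ex_derive.
  + by apply: cvg_at_right_filter; apply: (@cvgN _ R^o); exact: ch.
  + by apply: cvg_at_left_filter; apply: (@cvgN _ R^o); exact: ch.
- move=> x _; rewrite derive1N; last by rewrite /h; exact: ex_derive.
  rewrite /h derive1_comp; [|by []|by []].
  rewrite [(fun t => (g - 1) * t - g * s)^`()%classic x]derive1E.
  rewrite derive1E.
  have /funeqP -> := @derive_expR R.
  rewrite deriveB// derive_cst subr0 deriveMl// derive_id.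
  by rewrite /GRing.scale/=; ring.
Qed.

End exponential_law.

Section exponential_growth.
Context (R : realType).
Local Notation nu := (exponential1 R).

Definition below1 (y : R) : R := if y < 1 then y else 0.

Variables (g u : R).
Hypotheses (g0 : 0 < g) (u0 : 0 < u) (u1 : u <= 1).

Let s := - ln u / g.

Let s0 : 0 <= s.
Proof. by rewrite /s divr_ge0 ?(ltW g0)// oppr_ge0 ln_le0. Qed.

Let uE : u = expR (- (g * s)).
Proof. by rewrite /s mulrC divfK ?gt_eqF// opprK lnK// posrE. Qed.

Let growE t : u * expR (g * t) = expR (g * (t - s)).
Proof. by rewrite uE -expRD; congr expR; ring. Qed.

Let grow_lt1 t : (u * expR (g * t) < 1) = (t < s).
Proof. by rewrite growE -[X in _ < X]expR0 ltr_expR pmulr_rlt0// subr_lt0. Qed.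

Let grow_ge1 t : (1 <= u * expR (g * t)) = (s <= t).
Proof. by rewrite leNgt grow_lt1 -leNgt. Qed.

Let below1E t : below1 (u * expR (g * t)) = truncated_growth g s t.
Proof. by rewrite /below1 /truncated_growth grow_lt1 growE. Qed.

Let minE t : Num.min 1 (u * expR (g * t)) =
  truncated_growth g s t + \1_(`[s, +oo[%classic) t.
Proof.
rewrite -below1E /below1 indicE mem_setE in_itv/= andbT -grow_ge1.
by case: (ltP (u * _) 1) => h; rewrite ?addr0 ?add0r.
Qed.

(** For a standard exponential [T] and a regular [f], the mean increase of [f]
    up to [T] or [s], whichever is smaller, is the mean of [f'(T)] on [T < s].
    Here [f] is the exponential growth from [u], and [s] the time when it
    reaches 1. *)
Lemma exponential_min :
  (\int[nu]_t (Num.min 1 (u * expR (g * t)))%:E =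
   u%:E + g%:E * \int[nu]_t (below1 (u * expR (g * t)))%:E)%E.
Proof.
have [I [IE gI]] := exponential_truncated g s0.
have -> : (\int[nu]_t (below1 (u * expR (g * t)))%:E
  = I%:E)%E.
  by rewrite -IE; apply: eq_integral => t _; rewrite below1E.
under eq_integral do rewrite minE EFinD.
rewrite ge0_integralD//; last 3 first.
- by move=> t _; rewrite lee_fin truncated_growth_ge0.
- by apply/measurable_EFinP; exact: measurable_truncated_growth.
- by apply/measurable_EFinP; exact: measurable_indic.
rewrite IE integral_indic// setIT.
transitivity (I%:E + (expR (- s))%:E)%E.
  by congr (_ + _)%E; exact: exponential_tail.
rewrite -EFinM -!EFinD; congr EFin.
by move: gI; rewrite -uE => gI; lra.
Qed.

(** By lack of memory, given that the growth reaches 1 it goes on for an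
    independent exponential time, which is at most [ln (1 + e) / g] with
    probability at most [e / g]. *)
Lemma exponential_overshoot (e : R) : 0 < e ->
  (\int[nu]_t (if (1 <= u * expR (g * t) < 1 + e)%R then 1 else 0)%:E <=
   (e / g)%:E * \int[nu]_t (if (1 <= u * expR (g * t))%R then 1 else 0)%:E)%E.
Proof.
move=> e0; pose r := s + ln (1 + e) / g.
have e1 : 0 < 1 + e by rewrite addr_gt0.
have lne : 0 <= ln (1 + e) by rewrite ln_ge0// lerDl ltW.
have sr : s <= r by rewrite lerDl divr_ge0 // ltW.
have rE t : (u * expR (g * t) < 1 + e) = (t < r).
  rewrite growE -[X in _ < X]lnK ?posrE// ltr_expR /r.
  by rewrite -ltrBlDl ltr_pdivlMr// mulrC.
rewrite (_ : (\int[nu]_t _ = nu `[s, r[%classic)%E); last first.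
  transitivity (\int[nu]_t (\1_(`[s, r[%classic) t)%:E)%E.
    apply: eq_integral => t _; rewrite grow_ge1 rE indicE mem_setE in_itv/=.
    by case: (_ && _).
  by rewrite integral_indic// setIT.
rewrite (_ : (\int[nu]_t _ = nu `[s, +oo[%classic)%E); last first.
  transitivity (\int[nu]_t (\1_(`[s, +oo[%classic) t)%:E)%E.
    apply: eq_integral => t _; rewrite grow_ge1 indicE mem_setE in_itv/= andbT.
    by case: (_ <= _).
  by rewrite integral_indic// setIT.
have -> : nu `[s, r[%classic = (expR (- s) - expR (- r))%:E.
  have -> : `[s, r[%classic = `[s, +oo[%classic `\` `[r, +oo[%classic.
    apply/seteqP; split => t /=; rewrite !in_itv/= !andbT.
      by move=> /andP[-> tr]; split => //; apply/negP; rewrite -ltNge.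
    by move=> [-> /negP]; rewrite -ltNge.
  rewrite measureD//; last by rewrite (le_lt_trans (probability_le1 _ _))// ltry.
  have -> : `[s, +oo[%classic `&` `[r, +oo[%classic = `[r, +oo[%classic.
    apply/setIidr => t /=; rewrite !in_itv/= !andbT; exact: le_trans.
  rewrite EFinB; congr (_ - _)%E; apply: exponential_tail => //.
  exact: le_trans sr.
have -> : nu `[s, +oo[%classic = (expR (- s))%:E by exact: exponential_tail.
rewrite -EFinM lee_fin.
rewrite /r opprD expRD -[X in X - _]mulr1 -mulrBr mulrC ler_wpM2r ?expR_ge0//.
rewrite lerBlDr -lerBlDl (le_trans _ (expR_ge1Dx _))//.
rewrite lerD2l lerN2 ler_pM2r ?invr_gt0//.
by rewrite (le_trans (le_ln1Dx _))// (lt_trans _ e0)// ltrN10.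
Qed.

End exponential_growth.

(** * Laplace transforms at small exponents *)

Section small_exponent.
Context (R : realType) d (Omega : measurableType d) (P : probability Omega R).

Lemma integral_cst_probability (r : R) : (\int[P]_z r%:E)%E = r%:E.
Proof.
rewrite -[RHS]mule1 integral_cst//; congr (_ * _)%E; exact: probability_setT.
Qed.

Lemma expRB1_le (y : R) : expR y - 1 <= y * expR y.
Proof.
have h : (1 - y) * expR y <= expR (- y) * expR y.
  by apply: ler_wpM2r; [exact: expR_ge0|exact: expR_ge1Dx].
move: h; rewrite -expRD addNr expR0 mulrBl mul1r.
by rewrite !lerBlDr [_ + 1]addrC.
Qed.

(** The difference quotient at 0 of [t |-> expR (t * y)], with step [n.+1^-1]. *)
Let rate (n : nat) (y : R) := n.+1%:R * (expR (y / n.+1%:R) - 1).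

Let rate_ge n y : y <= rate n y.
Proof.
rewrite /rate mulrC -ler_pdivrMr ?ltr0n//.
by rewrite lerBrDl expR_ge1Dx.
Qed.

Let rate_le n y : rate n y <= y * expR (y / n.+1%:R).
Proof.
have := expRB1_le (y / n.+1%:R); rewrite /rate.
have n0 : (0 : R) < n.+1%:R by rewrite ltr0n.
rewrite -(ler_pM2l n0) => /le_trans; apply.
by rewrite mulrA [n.+1%:R * _]mulrC divfK ?gt_eqF.
Qed.

Let cvg_rate y : rate n y @[n --> \oo] --> y.
Proof.
apply: (@squeeze_cvgr _ _ _ _ (fun=> y) (fun n => y * expR (y / n.+1%:R))).
- by apply: nearW => n; rewrite rate_ge rate_le.
- exact: cvg_cst.
- rewrite -[X in _ --> X]mulr1; apply: cvgMr.
  rewrite -[X in _ --> X]expR0; apply: continuous_cvg; first exact: continuous_expR.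
  rewrite -[X in _ --> X](mulr0 y); apply: cvgMr; exact: cvg_harmonic.
Qed.

(** The derivative at [t = 0] of the mean of [expR (t * W)] is the mean of [W],
    which may be minus infinity; Fatou's lemma, applied to the difference
    quotients subtracted from an upper bound [B], gives the one inequality that
    is needed.  The conclusion says that the mean of [expR (t * (W + k * T))]
    is less than 1 for an independent standard exponential [T]. *)
Lemma small_exponent (W : Omega -> R) (w k : R) :
  measurable_fun setT W -> (forall z, W z <= w) ->
  (\int[P]_z (W z)%:E + k%:E < 0)%E ->
  forall t0 : R, 0 < t0 -> exists t : R, [/\ 0 < t, t < t0 &
    (\int[P]_z (expR (t * W z))%:E < (1 - t * k)%:E)%E].
Proof.
move=> mW Ww EW t0 t00.
have w' : exists B : R, 0 < B /\ forall n z, rate n (W z) <= B.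
  exists (`|w| * expR `|w| + 1); split.
    by rewrite ltr_wpDl// mulr_ge0// expR_ge0.
  move=> n z; rewrite -[leLHS]addr0 lerD//.
  have n0 : (0 : R) < n.+1%:R by rewrite ltr0n.
  apply: (@le_trans _ _ (rate n `|w|)).
    rewrite ler_pM2l// lerB// ler_expR ler_pM2r ?invr_gt0//.
    by rewrite (le_trans (Ww _))// ler_norm.
  apply: (le_trans (rate_le _ _)); apply: ler_wpM2l => //.
  rewrite ler_expR ler_pdivrMr// ler_peMr// ler1n//.
have {w'} [B [B0 rateB]] := w'.
have WB z : W z <= B by rewrite (le_trans (rate_ge 0 _)).
have mrate n : measurable_fun setT (fun z => rate n (W z)).
  apply: measurable_funM => //; apply: measurable_funB => //.
  apply: measurableT_comp; first exact: measurable_expR.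
  by apply: measurable_funM.
have step1 : ((B + k)%:E < \int[P]_z (B - W z)%:E)%E.
  have BW0 : (0 <= \int[P]_z (B - W z)%:E)%E.
    by apply: integral_ge0 => z _; rewrite lee_fin subr_ge0.
  have [->|Bfin] := eqVneq (\int[P]_z (B - W z)%:E)%E +oo%E; first exact: ltry.
  have iBW : P.-integrable setT (fun z => (B - W z)%:E).
    apply/integrableP; split; first by apply/measurable_EFinP; exact: measurable_funB.
    under eq_integral do rewrite gee0_abs ?lee_fin ?subr_ge0//.
    by rewrite ltey.
  have iB : P.-integrable setT (fun z => B%:E) by exact: finite_measure_integrable_cst.
  have EE : (\int[P]_z (W z)%:E = B%:E - \int[P]_z (B - W z)%:E)%E.
    have -> : B%:E = (\int[P]_z B%:E)%E.
      by rewrite integral_cst_probability.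
    rewrite -integralB//; apply: eq_integral => z _.
    by rewrite -EFinB; congr EFin; ring.
  move: EW; rewrite EE.
  have BWf : (\int[P]_z (B - W z)%:E)%E \is a fin_num.
    exact: integrable_fin_num.
  rewrite -(fineK BWf) -EFinB -EFinD !lte_fin; lra.
have step2 : ((B + k)%:E < limn_einf (fun n => \int[P]_z (B - rate n (W z))%:E))%E.
  apply: (lt_le_trans step1).
  rewrite (_ : (\int[P]_z _ = \int[P]_z limn_einf (fun n => (B - rate n (W z))%:E))%E).
    apply: fatou => //.
    - by move=> n; apply/measurable_EFinP; exact: measurable_funB.
    - by move=> n z _; rewrite lee_fin subr_ge0.
  apply: eq_integral => z _; apply/esym.
  have c : (B - rate n (W z))%:E @[n --> \oo] --> (B - W z)%:E.
    apply: cvg_EFin; first exact: nearW.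
    by apply: cvgB; [exact: cvg_cst|exact: cvg_rate].
  by have [-> _] := cvg_limn_einf_sup c.
move: step2; rewrite limn_einf_lim.
have := ereal_nondecreasing_cvgn (@nondecreasing_einfs _
  (fun n => \int[P]_z (B - rate n (W z))%:E)%E).
move=> /cvg_lim -> // /ereal_sup_gt[_ [N _ <-]] hN.
pose n := maxn N (Num.truncn t0^-1).
have n0 : (0 : R) < n.+1%:R by rewrite ltr0n.
exists (n.+1%:R^-1); split; first by rewrite invr_gt0.
  rewrite -[ltRHS]invrK ltf_pV2 ?posrE ?invr_gt0//.
  rewrite (lt_le_trans (truncnS_gt _))// ler_nat ltnS leq_maxr//.
have : ((B + k)%:E < \int[P]_z (B - rate n (W z))%:E)%E.
  apply: (lt_le_trans hN); apply: ereal_inf_lbound => /=.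
  by exists n => //=; rewrite leq_maxl.
have E1 z : B - rate n (W z) = B + n.+1%:R - n.+1%:R * expR (n.+1%:R^-1 * W z).
  by rewrite /rate [_^-1 * _]mulrC; ring.
under eq_integral do rewrite E1.
set J := (\int[P]_z (expR _)%:E)%E.
have mexp : measurable_fun setT (fun z => expR (n.+1%:R^-1 * W z)).
  apply: measurableT_comp; first exact: measurable_expR.
  by apply: measurable_funM.
have iE : P.-integrable setT (fun z => (expR (n.+1%:R^-1 * W z))%:E).
  apply/integrableP; split; first exact/measurable_EFinP.
  apply: (@le_lt_trans _ _ (\int[P]_z (expR (n.+1%:R^-1 * w))%:E)%E).
    apply: ge0_le_integral => //.
    - by apply: measurableT_comp => //; exact/measurable_EFinP.
    - move=> z _; rewrite lee_fin ger0_norm ?expR_ge0// ler_expR.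
      by rewrite ler_pM2l ?invr_gt0.
  by rewrite integral_cst_probability ltry.
have Jf : J \is a fin_num by exact: integrable_fin_num.
rewrite (_ : (\int[P]_z _ = (B + n.+1%:R)%:E - n.+1%:R%:E * J)%E); last first.
  under eq_integral do rewrite EFinB EFinM.
  rewrite integralB//.
  - by rewrite integral_cst_probability integralZl.
  - exact: finite_measure_integrable_cst.
  - exact: integrableZl.
rewrite -(fineK Jf) -EFinM -EFinB !lte_fin => h.
rewrite -(ltr_pM2l n0) mulrBr mulr1 mulrA divff ?gt_eqF// mul1r; lra.
Qed.

End small_exponent.

(** * Lifetimes and dislocations as one independent family *)

(** The lifetime of [u] is indexed by [inl u], its dislocation by [inr u]. *)
Definition site := (word + word)%type.
Definition site_word (j : site) : word := match j with inl u => u | inr u => u end.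

Section noise.
Context (R : realType) (d : measure_display) (Omega : measurableType d).
Context (P : probability Omega R).

Definition noise (T Y : word -> Omega -> R) (j : site) : Omega -> measurableTypeR R :=
  match j with inl u => T u | inr u => Y u end.

(** The regularity which the model has almost surely is required everywhere
    here. *)
Record driving_noise (T Y : word -> Omega -> R) : Prop := DrivingNoise {
  measurable_T : forall u, measurable_fun [set: Omega] (T u);
  measurable_Y : forall u, measurable_fun [set: Omega] (Y u);
  T_gt0 : forall u w, 0 < T u w;
  Y_ge : forall u w, 2^-1 <= Y u w;
  Y_lt1 : forall u w, Y u w < 1;
  T_law : forall u (A : set (measurableTypeR R)), measurable A ->
    P (T u @^-1` A) = exponential1 R A;
  Y_law : forall u (A : set (measurableTypeR R)), measurable A ->
    P (Y u @^-1` A) = P (Y [::] @^-1` A);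
  noise_indep : forall (s : seq site) (A : site -> set R), uniq s ->
    (forall j, measurable (A j)) ->
    P (\big[setI/setT]_(j <- s) (noise T Y j @^-1` A j)) =
    (\prod_(j <- s) P (noise T Y j @^-1` A j))%E }.

Variables (T Y : word -> Omega -> R).
Hypothesis TY : driving_noise T Y.

Local Notation without := (without (noise T Y)).

Lemma measurable_noise j : measurable_fun [set: Omega] (noise T Y j).
Proof. by case: j => u; [exact: (measurable_T TY)|exact: (measurable_Y TY)]. Qed.

Lemma measurable_without_T u j : inl u != j ->
  measurable_fun [set: without j] (T u : without j -> R).
Proof. exact: (@measurable_without _ _ _ _ _ (noise T Y) j (inl u)). Qed.

Lemma measurable_without_Y u j : inr u != j ->
  measurable_fun [set: without j] (Y u : without j -> R).
Proof. exact: (@measurable_without _ _ _ _ _ (noise T Y) j (inr u)). Qed.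

Lemma measurable_from_without j d' (S : measurableType d') (Z : Omega -> S) :
  measurable_fun [set: without j] (Z : without j -> S) ->
  measurable_fun [set: Omega] Z.
Proof.
apply: withoutW; [exact: measurable_noise|exact: (noise_indep TY)].
Qed.

Lemma integral_T u (f : R * R -> R) (Z : Omega -> R) :
  measurable_fun [set: without (inl u)] (Z : without (inl u) -> R) ->
  measurable_fun setT f -> (forall z, 0 <= f z) ->
  (\int[P]_w (f (Z w, T u w))%:E =
   \int[P]_w \int[exponential1 R]_t (f (Z w, t))%:E)%E.
Proof.
move=> mZ mf f0.
apply: (@indep_fubini _ _ _ P _ _ _ (noise T Y) measurable_noise
  (noise_indep TY) (inl u) (exponential1 R) _ (measurableTypeR R) Z (EFin \o f)).
- exact: (T_law TY).
- exact: mZ.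
- exact/measurable_EFinP.
- by move=> z; rewrite lee_fin.
Qed.

Lemma measurable_Y0 : measurable_fun [set: Omega] (Y [::] : Omega -> measurableTypeR R).
Proof. exact: (measurable_Y TY). Qed.

Lemma integral_Y u (phi : R -> R) (Z : Omega -> R) :
  measurable_fun [set: without (inr u)] (Z : without (inr u) -> R) ->
  measurable_fun setT phi -> (forall z, 0 <= phi z) -> (forall w, 0 <= Z w) ->
  (\int[P]_w (Z w * phi (Y u w))%:E =
   (\int[P]_w (Z w)%:E) * \int[P]_w (phi (Y [::] w))%:E)%E.
Proof.
move=> mZ mphi phi0 Z0.
pose Y0 : {RV P >-> (measurableTypeR R)} := HB.pack (Y [::] : Omega -> measurableTypeR R)
   (isMeasurableFun.Build _ _ _ _ _ measurable_Y0).
pose mu := distribution P Y0.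
have mphiE : measurable_fun [set: measurableTypeR R] (EFin \o phi) by exact/measurable_EFinP.
have -> : (\int[P]_w (phi (Y [::] w))%:E = \int[mu]_y (phi y)%:E)%E.
  by rewrite ge0_integral_distribution// => y; rewrite lee_fin.
have -> : (\int[P]_w (Z w * phi (Y u w))%:E =
   \int[P]_w \int[mu]_y (`|Z w| * phi y)%:E)%E.
  under eq_integral => w _ do rewrite -[Z w]ger0_norm//.
  apply: (@indep_fubini _ _ _ P _ _ _ (noise T Y) measurable_noise
    (noise_indep TY) (inr u) mu _ (measurableTypeR R) Z (fun z => (`|z.1| * phi z.2)%:E)).
  - exact: (Y_law TY).
  - exact: mZ.
  - apply/measurable_EFinP; apply: measurable_funM.
      by apply: measurableT_comp => //; exact: measurable_fst.
    by apply: measurableT_comp => //; exact: measurable_snd.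
  - by move=> z; rewrite lee_fin mulr_ge0.
transitivity (\int[P]_w ((Z w)%:E * \int[mu]_y (phi y)%:E))%E.
  apply: eq_integral => w _; rewrite ger0_norm//.
  under eq_integral do rewrite EFinM.
  by rewrite ge0_integralZl// => [y _|]; rewrite lee_fin.
rewrite ge0_integralZr//.
- by apply/measurable_EFinP; exact: (measurable_from_without mZ).
- by move=> w _; rewrite lee_fin.
- by apply: integral_ge0 => y _; rewrite lee_fin.
Qed.

End noise.

(** * Summable exponentials of random walks *)

Section walks.
Context (R : realType) (d : measure_display) (Omega : measurableType d).
Context (P : probability Omega R) (T Y : word -> Omega -> R).
Hypothesis TY : driving_noise P T Y.
Local Notation without := (without (noise T Y)).

Lemma integral_T1 u (l : R) (Z : Omega -> R) : l < 1 -> (forall w, 0 <= Z w) ->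
  measurable_fun [set: without (inl u)] (Z : without (inl u) -> R) ->
  (\int[P]_w (Z w * expR (l * T u w))%:E =
   (\int[P]_w (Z w)%:E) * ((1 - l)^-1)%:E)%E.
Proof.
move=> l1 Z0 mZ.
have mexp : measurable_fun [set: R] (fun t => expR (l * t)).
  apply: measurableT_comp; first exact: measurable_expR.
  by apply: measurable_funM.
under eq_integral => w _ do rewrite -[Z w]ger0_norm//.
rewrite (integral_T TY (f := fun z => `|z.1| * expR (l * z.2)) mZ); last 2 first.
- apply: measurable_funM; last exact: (measurableT_comp mexp measurable_snd).
  by apply: measurableT_comp => //; exact: measurable_fst.
- by move=> z; rewrite mulr_ge0 ?expR_ge0.
transitivity (\int[P]_w ((Z w)%:E * ((1 - l)^-1)%:E))%E.
  apply: eq_integral => w _ /=; rewrite ger0_norm//.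
  under eq_integral do rewrite EFinM.
  rewrite ge0_integralZl ?lee_fin//.
  - by rewrite exponential_mgf.
  - exact/measurable_EFinP.
rewrite ge0_integralZr//.
- by apply/measurable_EFinP; exact: (measurable_from_without TY mZ).
- by move=> w _; rewrite lee_fin.
- by rewrite lee_fin invr_ge0 subr_ge0 ltW.
Qed.

Section weight.
Variables (l : R) (phi : R -> R) (a : nat -> word).
Hypotheses (l1 : l < 1) (mphi : measurable_fun setT phi).
Hypotheses (phi0 : forall y, 0 <= phi y).
Hypothesis a_size : forall k, size (a k.+1) = (size (a k)).+1.

(** The exponential of a random walk along the words [a 0], [a 1], ..., taken at
    the death of [a k]: the lifetimes contribute the factors [expR (l * T)] and
    the dislocations the factors [phi Y]. *)
Fixpoint weight (k : nat) (w : Omega) : R :=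
  if k is k'.+1 then weight k' w * phi (Y (a k') w) * expR (l * T (a k) w)
  else expR (l * T (a 0) w).

Lemma weight_ge0 k w : 0 <= weight k w.
Proof. by elim: k => [|k IH] /=; rewrite ?mulr_ge0// expR_ge0. Qed.

Let a_lt i k : (i < k)%N -> (size (a i) < size (a k))%N.
Proof.
elim: k => // k IH; rewrite ltnS leq_eqVlt a_size => /predU1P[->|/IH] //.
by move=> h; rewrite ltnS ltnW.
Qed.

Let a_neq i k : (i < k)%N -> a i != a k.
Proof. by move=> /a_lt h; apply: contraTneq h => ->; rewrite ltnn. Qed.

Let mexpT u j : inl u != j ->
  measurable_fun [set: without j] (fun w : without j => expR (l * T u w)).
Proof.
move=> uj; apply: measurableT_comp; first exact: measurable_expR.
by apply: measurable_funM => //; exact: (measurable_without_T uj).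
Qed.

Lemma measurable_weight j k :
  (forall i, (i <= k)%N -> inl (a i) != j) ->
  (forall i, (i < k)%N -> inr (a i) != j) ->
  measurable_fun [set: without j] (weight k : without j -> R).
Proof.
elim: k => [|k IH] aj bj /=; first exact: (mexpT (aj 0 (leqnn 0))).
apply: measurable_funM; last exact: (mexpT (aj k.+1 (leqnn _))).
apply: measurable_funM.
  by apply: IH => i ik; [apply: aj; exact: leqW|apply: bj; exact: leqW].
by apply: measurableT_comp => //; exact: (measurable_without_Y (bj k (leqnn _))).
Qed.

(** The factors are functions of distinct variables, so the mean is a product. *)
Lemma integral_weight q k : (\int[P]_w (phi (Y [::] w))%:E = q%:E)%E ->
  (\int[P]_w (weight k w)%:E = ((1 - l)^-1 * (q / (1 - l)) ^+ k)%:E)%E.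
Proof.
move=> Eq; elim: k => [|k IH] /=.
  have := @integral_T1 (a 0) l (fun=> 1) l1 (fun=> ler01) (@measurable_cst _ _ _ _ setT _).
  under eq_integral do rewrite mul1r.
  by move=> ->; rewrite integral_cst_probability mul1e expr0 mulr1.
rewrite integral_T1//.
- rewrite (integral_Y TY)//.
  + by rewrite IH Eq -!EFinM exprS; congr EFin; ring.
  + by apply: measurable_weight => // i ik; apply/eqP => -[]; apply/eqP; exact: a_neq.
  + exact: weight_ge0.
- by move=> w; rewrite mulr_ge0 ?weight_ge0.
- apply: measurable_funM.
    apply: measurable_weight => // i ik; apply/eqP => -[]; apply/eqP; exact: a_neq.
  by apply: measurableT_comp => //; exact: measurable_without_Y.
Qed.

(** The means form a geometric series, so the sum has a finite mean. *)
Lemma weight_summable q : (\int[P]_w (phi (Y [::] w))%:E = q%:E)%E -> q < 1 - l ->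
  {ae P, forall w, exists M : R, forall n, \sum_(k < n) weight k w <= M}.
Proof.
move=> Eq ql.
have l1' : 0 < 1 - l by rewrite subr_gt0.
have q0 : 0 <= q.
  by rewrite -lee_fin -Eq integral_ge0// => w _; rewrite lee_fin.
have mw k : measurable_fun [set: Omega] (weight k).
  apply: (measurable_from_without TY (j := inr (a k))).
  by apply: measurable_weight => // i ik; apply/eqP => -[]; apply/eqP; exact: a_neq.
have ws w : (0 <= \sum_(0 <= k <oo) (weight k w)%:E)%E.
  by apply: nneseries_ge0 => k _ _; rewrite lee_fin weight_ge0.
have iw : P.-integrable setT (fun w => \sum_(0 <= k <oo) (weight k w)%:E)%E.
  apply/integrableP; split.
    apply: ge0_emeasurable_sum => [k w _ _|k _]; first by rewrite lee_fin weight_ge0.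
    exact/measurable_EFinP.
  under eq_integral do rewrite gee0_abs//.
  rewrite integral_nneseries//; last 2 first.
  - by move=> k; apply/measurable_EFinP.
  - by move=> k w _; rewrite lee_fin weight_ge0.
  under eq_eseriesr do rewrite (integral_weight _ Eq).
  have c : cvgn (series (fun k => (1 - l)^-1 * (q / (1 - l)) ^+ k)).
    apply: is_cvg_geometric_series.
    have ql1 : q / (1 - l) < 1 by rewrite ltr_pdivrMr// mul1r.
    by rewrite ger0_norm// divr_ge0// ltW.
  rewrite (_ : (\sum_(0 <= k <oo) _ =
    (limn (series (fun k => (1 - l)^-1 * (q / (1 - l)) ^+ k)))%:E)%E); first exact: ltry.
  rewrite -EFin_lim//; congr (limn _); apply/funext => n.
  by rewrite /= /series/= sumEFin.
have := integrable_ae measurableT iw; apply: filterS => w /(_ Logic.I) fw.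
exists (fine (\sum_(0 <= k <oo) (weight k w)%:E)%E) => n.
rewrite -lee_fin fineK// -sumEFin -(big_mkord xpredT (fun k => (weight k w)%:E)).
by apply: nneseries_lim_ge => k _; rewrite lee_fin weight_ge0.
Qed.

End weight.

End walks.

Lemma bounded_series_small (R : realType) (D : nat -> R) (M e : R) :
  (forall k, 0 <= D k) -> (forall n, \sum_(k < n) D k <= M) -> 0 < e ->
  exists N, forall k, (N <= k)%N -> D k < e.
Proof.
move=> D0 DM e0.
have c : cvgn (series D).
  apply: nondecreasing_is_cvgn.
    apply/nondecreasing_seqP => n; rewrite /series/= big_nat_recr//= lerDl//.
  by exists M => _ [n _ <-]; rewrite /series/= big_mkord.
have /cvgrPdist_lt/(_ e e0)[N _ hN] := cvg_series_cvg_0 c.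
exists N => k Nk; have := hN k Nk; rewrite /= sub0r normrN ger0_norm//.
Qed.

(** * Probability bounds *)

Section probability_bounds.
Context (R : realType) (d : measure_display) (Omega : measurableType d).
Context (P : probability Omega R).

Lemma measurable_bool_set d' (O : measurableType d') (b : O -> bool) :
  measurable_fun setT b -> measurable [set w | b w].
Proof.
move=> mb; have := mb measurableT [set true] Logic.I; rewrite setTI.
by congr measurable; apply/seteqP; split => w /= ->.
Qed.

Lemma probability_bigcup_le (F : (set Omega)^nat) (e : \bar R) :
  (forall n, measurable (F n)) -> nondecreasing_seq F ->
  (forall n, P (F n) <= e)%E -> (P (\bigcup_n F n) <= e)%E.
Proof.
move=> mF ndF Fe.
have c := @nondecreasing_cvg_mu _ _ _ P F mF (bigcupT_measurable _ mF) ndF.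
rewrite -(cvg_lim _ c)//; apply: lime_le; first by apply/cvg_ex; eexists; exact: c.
by apply: nearW => n; exact: Fe.
Qed.

(** Markov's inequality for the partial sums, which increase. *)
Lemma markov_partial_sums (s : nat -> Omega -> R) (C M : R) :
  (forall k, measurable_fun setT (s k)) -> (forall k w, 0 <= s k w) ->
  (forall n, (\sum_(k < n) \int[P]_w (s k w)%:E <= C%:E)%E) -> 0 < M ->
  measurable [set w | exists n, M < \sum_(k < n) s k w] /\
  (P [set w | exists n, (M < \sum_(k < n) s k w)%R] <= (C / M)%:E)%E.
Proof.
move=> ms s0 sC M0.
pose F n := [set w | M < \sum_(k < n) s k w].
have mS n : measurable_fun setT (fun w => \sum_(k < n) s k w).
  exact: measurable_sum.
have mF n : measurable (F n).
  by apply: measurable_bool_set; apply: measurable_fun_ltr => //; exact: mS.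
have -> : [set w | exists n, M < \sum_(k < n) s k w] = \bigcup_n F n.
  by apply/seteqP; split => [w [n hn]|w [n _ hn]]; exists n.
split; first exact: bigcupT_measurable.
apply: probability_bigcup_le => //.
  apply/nondecreasing_seqP => n; apply/subsetPset => w /= h.
  by rewrite /F/= big_ord_recr/= (lt_le_trans h)// lerDl.
move=> n; rewrite EFinM lee_pdivlMr//.
apply: (le_trans _ (sC n)).
rewrite -ge0_integral_sum//; last 2 first.
- by move=> k; exact/measurable_EFinP.
- by move=> k w _; rewrite lee_fin.
rewrite muleC -[F n]setIT -integral_indic// -ge0_integralZl ?lee_fin ?(ltW M0)//; last first.
  by apply/measurable_EFinP; exact: measurable_indic.
apply: ge0_le_integral => //.
- by move=> w _; rewrite mule_ge0// lee_fin ltW.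
- apply: emeasurable_funM => //; apply/measurable_EFinP; exact: measurable_indic.
- under eq_fun do rewrite sumEFin; exact/measurable_EFinP.
- move=> w _; rewrite sumEFin -EFinM lee_fin indicE.
  case: (boolP (w \in F n)); rewrite ?inE ?mulr1 ?mulr0 => h; first exact: ltW.
  exact: sumr_ge0.
Qed.

End probability_bounds.

(** * A Lyapunov function up to the first passage *)

Section lyapunov.
Context (R : realType) (d : measure_display) (Omega : measurableType d).
Context (P : probability Omega R) (T Y : word -> Omega -> R).
Hypothesis TY : driving_noise P T Y.
Local Notation without := (without (noise T Y)).

Variables (b g m : R) (a : nat -> word) (U0 : Omega -> R).
Hypotheses (b0 : 0 < b) (g0 : 0 < g).
Hypothesis a_size : forall k, size (a k.+1) = (size (a k)).+1.
Hypotheses (U0_gt0 : forall w, 0 < U0 w) (U0_le1 : forall w, U0 w <= 1).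
Hypothesis mU0 : forall j, (size (a 0) <= size (site_word j))%N ->
  measurable_fun [set: without j] (U0 : without j -> R).
Hypothesis Em : (\int[P]_w (expR (b * ln (Y [::] w)))%:E = m%:E)%E.
Hypothesis gm : 1 - m < g.

(** For words [a 0], [a 1], ..., each the larger child of the preceding one,
    [level k] is [e^(b xi)] at the birth of [a k] and [grown k] is its value at
    the death, as long as it has stayed below 1; from the first passage at 1 on,
    [level] is 1.  The hypothesis [gm] says that it increases on average: it
    grows at rate [g] and a dislocation multiplies it by [m] on average. *)
Fixpoint level (k : nat) (w : Omega) : R :=
  if k is k'.+1 then
    let W := level k' w * expR (g * T (a k') w) in
    if W < 1 then W * expR (b * ln (Y (a k') w)) else 1
  else U0 w.

Definition grown k w := level k w * expR (g * T (a k) w).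

Lemma levelS k w : level k.+1 w =
  if grown k w < 1 then grown k w * expR (b * ln (Y (a k) w)) else 1.
Proof. by []. Qed.

Lemma level_gt0 k w : 0 < level k w.
Proof.
elim: k => [|k IH] /=; first exact: U0_gt0.
by case: ifP => // _; rewrite !mulr_gt0 ?expR_gt0.
Qed.

Lemma grown_gt0 k w : 0 < grown k w.
Proof. by rewrite mulr_gt0 ?level_gt0 ?expR_gt0. Qed.

Lemma level_le1 k w : level k w <= 1.
Proof.
case: k => [|k]; first exact: U0_le1.
rewrite levelS; case: ifPn => // h; rewrite -[leRHS]mulr1.
apply: ler_pM; [exact/ltW/grown_gt0|exact: expR_ge0|exact: ltW|].
rewrite -[leRHS]expR0 ler_expR pmulr_rle0// ln_le0// ltW//; exact: (Y_lt1 TY).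
Qed.

Lemma level_le_grown k w : level k w <= Num.min 1 (grown k w).
Proof.
rewrite le_min level_le1/= /grown ler_pMr ?level_gt0//.
rewrite -[leLHS]expR0 ler_expR mulr_ge0// ltW//; exact: (T_gt0 TY).
Qed.

Lemma measurable_grown_of j k : inl (a k) != j ->
  measurable_fun [set: without j] (level k : without j -> R) ->
  measurable_fun [set: without j] (grown k : without j -> R).
Proof.
move=> aj mk; apply: measurable_funM => //.
apply: measurableT_comp; first exact: measurable_expR.
by apply: measurable_funM => //; exact: (measurable_without_T aj).
Qed.

Let size_neq (f : word -> site) (h : forall u, site_word (f u) = u) k j :
  (size (a k) < size (site_word j))%N -> f (a k) != j.
Proof. by apply: contraTneq => <-; rewrite h ltnn. Qed.

Lemma measurable_level j k : (size (a k) <= size (site_word j))%N ->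
  measurable_fun [set: without j] (level k : without j -> R).
Proof.
elim: k => [|k IH] kj; first exact: mU0.
have kj' : (size (a k) < size (site_word j))%N by rewrite -a_size.
have mg : measurable_fun [set: without j] (grown k : without j -> R).
  apply: measurable_grown_of; [|exact: (IH (ltnW kj'))].
  exact: (@size_neq inl (fun=> erefl) _ _ kj').
apply: measurable_fun_ifT => //.
- by apply: measurable_fun_ltr => //; exact: mg.
- apply: measurable_funM; first exact: mg.
  apply: measurableT_comp; first exact: measurable_expR.
  apply: measurable_funM => //; apply: measurableT_comp => //.
  by apply: measurable_without_Y; exact: (@size_neq inr (fun=> erefl) _ _ kj').
Qed.

Lemma measurable_grown j k : (size (a k) <= size (site_word j))%N ->
  inl (a k) != j -> measurable_fun [set: without j] (grown k : without j -> R).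
Proof. by move=> kj aj; apply: measurable_grown_of => //; exact: measurable_level. Qed.

Let mlevel k : measurable_fun setT (level k).
Proof.
apply: (measurable_from_without TY (j := inr (a k))).
exact: measurable_level.
Qed.

Let mgrown k : measurable_fun setT (grown k).
Proof.
apply: (measurable_from_without TY (j := inr (a k))).
exact: measurable_grown.
Qed.

Lemma measurable_below1 : measurable_fun setT (@below1 R).
Proof. by apply: measurable_fun_ifT => //; exact: measurable_fun_ltr. Qed.

Lemma below1_ge0 (y : R) : 0 <= y -> 0 <= below1 y.
Proof. by rewrite /below1; case: ifP. Qed.

Lemma below1_le1 (y : R) : below1 y <= 1.
Proof. by rewrite /below1; case: ifPn => // /ltW. Qed.

Let bounded_fin (f : Omega -> R) : measurable_fun setT f ->
  (forall w, 0 <= f w <= 1) -> (\int[P]_w (f w)%:E)%E \is a fin_num.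
Proof.
move=> mf f01; rewrite ge0_fin_numE; last first.
  by apply: integral_ge0 => w _; rewrite lee_fin; have /andP[] := f01 w.
apply: (@le_lt_trans _ _ (\int[P]_w 1%:E)%E); last first.
  by rewrite integral_cst_probability ltry.
apply: ge0_le_integral => //.
- by move=> w _; rewrite lee_fin; have /andP[] := f01 w.
- exact/measurable_EFinP.
- by move=> w _; rewrite lee_fin; have /andP[] := f01 w.
Qed.

Let mbelow k : measurable_fun setT (fun w => below1 (grown k w)).
Proof. exact: measurableT_comp measurable_below1 (mgrown k). Qed.

Let mmin k : measurable_fun setT (fun w => Num.min 1 (grown k w)).
Proof. by apply: measurable_minr => //; exact: mgrown. Qed.

Let min_ge0 k w : 0 <= Num.min 1 (grown k w).
Proof. by rewrite le_min ler01 ltW// grown_gt0. Qed.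

(** The lifetime of [a k] is independent of [level k], so it can be integrated
    first. *)
Lemma integral_min_grown k :
  (\int[P]_w (Num.min 1 (grown k w))%:E =
   \int[P]_w (level k w)%:E + g%:E * \int[P]_w (below1 (grown k w))%:E)%E.
Proof.
have mk : measurable_fun [set: without (inl (a k))] (level k : without (inl (a k)) -> R).
  exact: measurable_level.
have mx : measurable_fun setT (fun z : R * R => `|z.1| * expR (g * z.2)).
  apply: measurable_funM.
    by apply: measurableT_comp => //; exact: measurable_fst.
  apply: measurableT_comp; first exact: measurable_expR.
  by apply: measurable_funM => //; exact: measurable_snd.
have lE w : `|level k w| = level k w by rewrite ger0_norm// ltW// level_gt0.
have x0 (z : R * R) : 0 <= `|z.1| * expR (g * z.2) by rewrite mulr_ge0 ?expR_ge0.
have -> : (\int[P]_w (Num.min 1 (grown k w))%:E = \int[P]_w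
    \int[exponential1 R]_t (Num.min 1 (`|level k w| * expR (g * t)))%:E)%E.
  rewrite -(integral_T TY (f := fun z => Num.min 1 (`|z.1| * expR (g * z.2))) mk)//.
  - by apply: eq_integral => w _ /=; rewrite lE.
  - exact: measurable_minr.
have -> : (\int[P]_w (below1 (grown k w))%:E = \int[P]_w
    \int[exponential1 R]_t (below1 (`|level k w| * expR (g * t)))%:E)%E.
  rewrite -(integral_T TY (f := fun z => below1 (`|z.1| * expR (g * z.2))) mk)//.
  - by apply: eq_integral => w _ /=; rewrite lE.
  - exact: measurableT_comp measurable_below1 mx.
  - by move=> z; exact: below1_ge0.
under eq_integral do rewrite lE (exponential_min g0 (level_gt0 k _) (level_le1 k _)).
have mh : measurable_fun setT
    (fun w => \int[exponential1 R]_t (below1 (`|level k w| * expR (g * t)))%:E)%E.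
  have mf : measurable_fun setT (fun z : measurableTypeR R * measurableTypeR R =>
      (below1 (`|(z.1 : R)| * expR (g * z.2)))%:E).
    by apply/measurable_EFinP; exact: measurableT_comp measurable_below1 mx.
  have hF : measurable_fun setT (fun u : measurableTypeR R =>
      \int[exponential1 R]_t (below1 (`|(u : R)| * expR (g * t)))%:E)%E.
    apply: (@measurable_fun_fubini_tonelli_F _ _ _ _ R (exponential1 R) _ mf).
    by move=> z; rewrite lee_fin below1_ge0.
  exact: (measurableT_comp hF (mlevel k)).
have h0 w : (0 <= \int[exponential1 R]_t (below1 (`|level k w| * expR (g * t)))%:E)%E.
  apply: integral_ge0 => t _; rewrite lee_fin below1_ge0// mulr_ge0//; exact: expR_ge0.
rewrite ge0_integralD//; last 4 first.
- by move=> w _; rewrite lee_fin ltW// level_gt0.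
- exact/measurable_EFinP.
- by move=> w _; rewrite mule_ge0 ?lee_fin ?(ltW g0)//; move: (h0 w); rewrite lE.
- apply: emeasurable_funM => //; move: mh; by under eq_fun do rewrite lE.
congr (_ + _)%E; rewrite -ge0_integralZl ?lee_fin ?(ltW g0)//.
by apply: eq_integral => w _; rewrite lE.
Qed.

(** Both sums count [grown k] capped at 1, with the dislocation acting only on
    the part below 1.  They are written as sums to avoid differences of
    extended reals. *)
Lemma integral_levelS k :
  (\int[P]_w (level k.+1 w)%:E + \int[P]_w (below1 (grown k w))%:E =
   \int[P]_w (Num.min 1 (grown k w))%:E + m%:E * \int[P]_w (below1 (grown k w))%:E)%E.
Proof.
have my : measurable_fun [set: R] (fun y => expR (b * ln y)).
  apply: measurableT_comp; first exact: measurable_expR.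
  by apply: measurable_funM => //; exact: measurable_ln.
have := @integral_Y _ _ _ P T Y TY (a k) (fun y => expR (b * ln y))
  (fun w => below1 (grown k w)) _ my (fun y => expR_ge0 _) _.
rewrite Em muleC => <-; last 2 first.
- apply: (measurableT_comp measurable_below1); exact: measurable_grown.
- by move=> w; rewrite below1_ge0// ltW// grown_gt0.
have b1 w : 0 <= below1 (grown k w) by rewrite below1_ge0// ltW// grown_gt0.
have mE : measurable_fun setT
    (fun w => below1 (grown k w) * expR (b * ln (Y (a k) w))).
  apply: measurable_funM => //.
  by apply: (measurableT_comp my); exact: (measurable_Y TY).
rewrite -!ge0_integralD//; try by exact/measurable_EFinP.
- apply: eq_integral => w _; rewrite -!EFinD levelS /below1 minElt; congr EFin.
  rewrite [1 < _]ltNge; case: (ltP (grown k w) 1) => h.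
    by rewrite (ltW h)/= addrC.
  rewrite mul0r !addr0; case: ifPn => //; rewrite negbK => h'.
  by apply/le_anti; rewrite h h'.
- by move=> w _; rewrite lee_fin.
- by move=> w _; rewrite lee_fin mulr_ge0 ?expR_ge0.
- by move=> w _; rewrite lee_fin ltW// (level_gt0 k.+1).
- by move=> w _; rewrite lee_fin.
Qed.

(** The mean of [level] increases at the [k]-th step by [g + m - 1] times the
    mean [B k] of the part of [grown k] below 1, while the mean growth at this
    step is [g * B k].  As [level] is at most 1, the sum of the [B k] is at most
    [1 / (g + m - 1)]. *)
Lemma integral_growth_sum n :
  (\sum_(k < n) \int[P]_w (Num.min 1 (grown k w) - level k w)%:E <=
   (g / (g + m - 1))%:E)%E.
Proof.
pose B k := fine (\int[P]_w (below1 (grown k w))%:E)%E.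
pose L k := fine (\int[P]_w (level k w)%:E)%E.
have BE k : (\int[P]_w (below1 (grown k w))%:E = (B k)%:E)%E.
  rewrite fineK// bounded_fin// => w.
  by rewrite below1_le1 below1_ge0// ltW// grown_gt0.
have LE k : (\int[P]_w (level k w)%:E = (L k)%:E)%E.
  by rewrite fineK// bounded_fin// => w; rewrite level_le1 ltW// level_gt0.
have VE k : (\int[P]_w (Num.min 1 (grown k w))%:E = (L k + g * B k)%:E)%E.
  by rewrite integral_min_grown BE LE -EFinM -EFinD.
have LS k : L k.+1 - L k = (g + m - 1) * B k.
  have := integral_levelS k; rewrite VE BE LE -EFinM -!EFinD => -[]; lra.
have DE k : (\int[P]_w (Num.min 1 (grown k w) - level k w)%:E = (g * B k)%:E)%E.
  under eq_integral do rewrite EFinB.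
  rewrite integralB_EFin//.
  - by rewrite VE LE -EFinB; congr EFin; ring.
  - apply/integrableP; split; first exact/measurable_EFinP.
    under eq_integral do rewrite gee0_abs ?lee_fin//.
    by rewrite VE ltry.
  - apply/integrableP; split; first exact/measurable_EFinP.
    under eq_integral do rewrite gee0_abs ?lee_fin ?(ltW (level_gt0 k _))//.
    by rewrite LE ltry.
under eq_bigr do rewrite DE.
rewrite sumEFin lee_fin.
have gm0 : 0 < g + m - 1 by move: gm; lra.
have tel : \sum_(k < n) ((g + m - 1) * B k) = L n - L 0.
  rewrite -(big_mkord xpredT (fun k => (g + m - 1) * B k)) -telescope_sumr//.
  by apply: eq_bigr => k _; rewrite LS.
have L1 k : L k <= 1.
  rewrite -lee_fin -LE -[leRHS](@integral_cst_probability _ _ _ P 1).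
  apply: ge0_le_integral => //.
  - by move=> w _; rewrite lee_fin ltW// level_gt0.
  - exact/measurable_EFinP.
  - by move=> w _; rewrite lee_fin level_le1.
have L0 k : 0 <= L k.
  by rewrite fine_ge0// integral_ge0// => w _; rewrite lee_fin ltW// level_gt0.
rewrite ler_pdivlMr// -mulr_sumr -mulrA ler_piMr ?(ltW g0)//.
by rewrite mulrC mulr_sumr tel lerBlDr (le_trans (L1 n))// lerDl.
Qed.

Lemma measurable_growth k :
  measurable_fun setT (fun w => Num.min 1 (grown k w) - level k w).
Proof. by apply: measurable_funB; [exact: mmin|exact: mlevel]. Qed.

Definition crossing k w : R := if level k w < 1 <= grown k w then 1 else 0.

Definition overshoot (e : R) k w : R :=
  if (level k w < 1) && (1 <= grown k w < 1 + e) then 1 else 0.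

(** After a crossing, [level] is 1 forever. *)
Lemma sum_crossing_le1 n w : \sum_(k < n) crossing k w <= 1.
Proof.
suff : \sum_(k < n) crossing k w <= (if level n w < 1 then 0 else 1).
  by move=> /le_trans; apply; case: ifP.
elim: n => [|n IH]; first by rewrite big_ord0; case: ifP.
rewrite big_ord_recr; apply: (le_trans (lerD IH (lexx _))).
rewrite levelS /crossing; case: (ltP (level n w) 1) => h.
  by rewrite add0r; case: (leP 1 (grown n w)) => // h'; rewrite ?ltxx//; case: ifP.
have g1 : 1 <= grown n w.
  by rewrite (le_trans h)// (le_trans (level_le_grown n w))// ge_min lexx orbT.
by rewrite [grown n w < 1]ltNge g1/= ltxx addr0.
Qed.

Let measurable_level_lt1 k : measurable_fun setT (fun w => level k w < 1).
Proof. by apply: measurable_fun_ltr => //; exact: mlevel. Qed.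

Lemma measurable_crossing k : measurable_fun setT (crossing k).
Proof.
apply: measurable_fun_ifT => //; apply: measurable_and => //.
by apply: measurable_fun_ler => //; exact: mgrown.
Qed.

Lemma measurable_overshoot e k : measurable_fun setT (overshoot e k).
Proof.
apply: measurable_fun_ifT => //; apply: measurable_and => //.
apply: measurable_and.
- by apply: measurable_fun_ler => //; exact: mgrown.
- by apply: measurable_fun_ltr => //; exact: mgrown.
Qed.

(** Integration of the lifetime of [a k] first, on an event that depends on the
    past and on [grown k]. *)
Let integral_window k (b1 : R -> bool) : measurable_fun setT b1 ->
  (\int[P]_w (if (level k w < 1)%R && b1 (grown k w) then 1%R else 0%R)%:E =
   \int[P]_w (if (level k w < 1)%R then
     \int[exponential1 R]_t (if b1 (level k w * expR (g * t)) then 1%R else 0%R)%:E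
     else 0))%E.
Proof.
move=> mb1.
have mk : measurable_fun [set: without (inl (a k))] (level k : without (inl (a k)) -> R).
  exact: measurable_level.
rewrite (integral_T TY (f := fun z =>
  if (z.1 < 1) && b1 (z.1 * expR (g * z.2)) then 1 else 0) mk).
- apply: eq_integral => w _ /=; case: ifP => // _.
  by rewrite integral0.
- apply: measurable_fun_ifT => //; apply: measurable_and.
    by apply: measurable_fun_ltr => //; exact: measurable_fst.
  apply: measurableT_comp => //; apply: measurable_funM; first exact: measurable_fst.
  apply: measurableT_comp; first exact: measurable_expR.
  by apply: measurable_funM => //; exact: measurable_snd.
- by move=> z; case: ifP.
Qed.

Let measurable_window k (b1 : R -> bool) : measurable_fun setT b1 ->
  measurable_fun setT (fun w => if (level k w < 1)%R then
     \int[exponential1 R]_t (if b1 (level k w * expR (g * t)) then 1%R else 0%R)%:E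
     else 0)%E.
Proof.
move=> mb1; apply: measurable_fun_ifT => //.
have mf : measurable_fun setT (fun z : measurableTypeR R * measurableTypeR R =>
    (if b1 ((z.1 : R) * expR (g * z.2)) then 1 else 0 : R)%:E).
  apply/measurable_EFinP; apply: measurable_fun_ifT => //.
  apply: measurableT_comp => //; apply: measurable_funM; first exact: measurable_fst.
  apply: measurableT_comp; first exact: measurable_expR.
  by apply: measurable_funM => //; exact: measurable_snd.
have hF : measurable_fun setT (fun u : measurableTypeR R =>
    \int[exponential1 R]_t (if b1 ((u : R) * expR (g * t)) then 1%R else 0%R)%:E)%E.
  apply: (@measurable_fun_fubini_tonelli_F _ _ _ _ R (exponential1 R) _ mf).
  by move=> z; case: ifP.
exact: (measurableT_comp hF (mlevel k)).
Qed.

Lemma integral_overshoot_le e k : 0 < e ->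
  (\int[P]_w (overshoot e k w)%:E <= (e / g)%:E * \int[P]_w (crossing k w)%:E)%E.
Proof.
move=> e0; have eg : 0 <= e / g by rewrite divr_ge0 ?(ltW e0) ?(ltW g0).
have mc : measurable_fun setT (fun w => (crossing k w)%:E).
  by apply/measurable_EFinP; exact: measurable_crossing.
have c0 w : 0 <= crossing k w by rewrite /crossing; case: ifP.
rewrite /overshoot /crossing.
rewrite (@integral_window k (fun y => 1 <= y < 1 + e)); last first.
  by apply: measurable_and; [exact: measurable_fun_ler|exact: measurable_fun_ltr].
rewrite (@integral_window k (fun y => 1 <= y)); last exact: measurable_fun_ler.
have i0 (b1 : R -> bool) w :
  (0 <= \int[exponential1 R]_t (if b1 (level k w * expR (g * t)) then 1%R else 0%R)%:E)%E.
  by apply: integral_ge0 => t _; case: ifP.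
rewrite -ge0_integralZl//; last 2 first.
- by apply: (@measurable_window k (fun y => 1 <= y)); exact: measurable_fun_ler.
- by move=> w _; case: ifP => // _; exact: (i0 (fun y => 1 <= y)).
apply: ge0_le_integral => //.
- by move=> w _; case: ifP => // _; exact: (i0 (fun y => 1 <= y < 1 + e)).
- apply: (@measurable_window k (fun y => 1 <= y < 1 + e)).
  by apply: measurable_and; [exact: measurable_fun_ler|exact: measurable_fun_ltr].
- apply: emeasurable_funM => //.
  by apply: (@measurable_window k (fun y => 1 <= y)); exact: measurable_fun_ler.
- move=> w _; case: ifP => _; last by rewrite mule0.
  exact: (exponential_overshoot g0 (level_gt0 k w) (level_le1 k w) e0).
Qed.

Lemma integral_overshoot_sum e n : 0 < e ->
  (\sum_(k < n) \int[P]_w (overshoot e k w)%:E <= (e / g)%:E)%E.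
Proof.
move=> e0; have eg : 0 <= e / g by rewrite divr_ge0 ?(ltW e0) ?(ltW g0).
have c0 k w : (0 <= (crossing k w)%:E)%E by rewrite /crossing; case: ifP.
have mc k : measurable_fun setT (fun w => (crossing k w)%:E).
  by apply/measurable_EFinP; exact: measurable_crossing.
apply: (@le_trans _ _ (\sum_(k < n) ((e / g)%:E * \int[P]_w (crossing k w)%:E))%E).
  by apply: lee_sum => k _; exact: integral_overshoot_le.
rewrite -ge0_sume_distrr; last by move=> k _; exact: integral_ge0.
rewrite -[leRHS]mule1; apply: lee_wpmul2l; first by rewrite lee_fin.
rewrite -ge0_integral_sum// -[leRHS](@integral_cst_probability _ _ _ P 1).
apply: ge0_le_integral => //.
- by move=> w _; exact: sume_ge0.
- under eq_fun do rewrite sumEFin; apply/measurable_EFinP; apply: measurable_sum => k.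
  exact: measurable_crossing.
- by move=> w _; rewrite sumEFin lee_fin sum_crossing_le1.
Qed.

End lyapunov.

(** * The time change along a ray *)

(** The integral of a nonnegative function is a supremum over the simple
    functions below it, hence monotone in the domain for arbitrary functions;
    [xi_ray] is controlled only up to an accumulation of births on the ray. *)
Lemma ge0_subset_integralW d (O : measurableType d) (R : realType)
    (mu : {measure set O -> \bar R}) (A B : set O) (f : O -> \bar R) :
  (forall z, 0 <= f z)%E -> A `<=` B ->
  (\int[mu]_(z in A) f z <= \int[mu]_(z in B) f z)%E.
Proof.
move=> f0 AB; rewrite (integral_mkcond A) (integral_mkcond B).
rewrite !ge0_integralTE; try by move=> z; rewrite patchE; case: ifP.
apply: ge_ereal_sup => _ [h hA <-]; apply: ereal_sup_ubound; exists h => // z.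
apply: (le_trans (hA z)); rewrite !patchE; case: ifPn => // zA.
  by rewrite mem_set//; apply: AB; exact: set_mem.
by case: ifP.
Qed.

Section clock.
Context (R : realType) (b c x : R) (T Y : word -> R).
Local Notation zeta := (zeta c x T Y).

(** The self-similar birth time of [u] multiplied by [b * c]; with this factor,
    it is the total increase of [e^(b xi)] during the lives of the ancestors of
    [u]. *)
Definition clock (u : word) : R :=
  \sum_(i < size u) (expR (b * (zeta (take i u) + c * T (take i u))) -
                     expR (b * zeta (take i u))).

Lemma sum_take_rcons (F : word -> R) (u : word) l :
  \sum_(i < size (rcons u l)) F (take i (rcons u l)) =
  \sum_(i < size u) F (take i u) + F u.
Proof.
rewrite size_rcons big_ord_recr/= -cats1 take_size_cat//; congr (_ + _).
by apply: eq_bigr => i _; rewrite takel_cat// ltnW.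
Qed.

Lemma clock_rcons u l : clock (rcons u l) =
  clock u + (expR (b * (zeta u + c * T u)) - expR (b * zeta u)).
Proof. exact: (sum_take_rcons (fun u => expR _ - expR _)). Qed.

Lemma birth_rcons u l : birth T (rcons u l) = death T u.
Proof. exact: sum_take_rcons. Qed.

End clock.

Section rays.
Context (R : realType) (alpha b c x : R) (T Y : word -> R).
Hypotheses (bE : b = - alpha) (b0 : 0 < b) (c0 : 0 < c).
Hypothesis T0 : forall u, 0 < T u.
Local Notation zeta := (zeta c x T Y).
Local Notation clockTY := (clock b c x T Y).
Local Notation leb := (@lebesgue_measure R).

Let bc0 : 0 < b * c. Proof. by rewrite mulr_gt0. Qed.

Let mkseqS (v : ray) n : mkseq v n.+1 = rcons (mkseq v n) (v n).
Proof. by rewrite /mkseq -addn1 iotaD map_cat cats1. Qed.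

Lemma ray_prefix_mkseq (v : ray) n : ray_prefix (mkseq v n) v.
Proof. by rewrite /ray_prefix size_mkseq. Qed.

Lemma birth_mkseq_le (v : ray) m n : (m <= n)%N ->
  birth T (mkseq v m) <= birth T (mkseq v n).
Proof.
elim: n => [|n IH]; first by rewrite leqn0 => /eqP ->.
rewrite leq_eqVlt => /predU1P[->//|/IH /le_trans]; apply.
by rewrite mkseqS birth_rcons /death lerDl ltW.
Qed.

(** The lifetimes of the individuals on a ray are successive half-open
    intervals. *)
Lemma alive_unique (v : ray) m n r :
  birth T (mkseq v m) <= r < death T (mkseq v m) ->
  birth T (mkseq v n) <= r < death T (mkseq v n) -> m = n.
Proof.
have key p q : birth T (mkseq v p) <= r < death T (mkseq v p) ->
    birth T (mkseq v q) <= r < death T (mkseq v q) -> (q <= p)%N.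
  move=> /andP[_ rp] /andP[qr _]; rewrite leqNgt; apply/negP => pq.
  have := birth_mkseq_le v pq; rewrite mkseqS birth_rcons => h.
  by have := lt_le_trans rp (le_trans h qr); rewrite ltxx.
by move=> hm hn; apply/eqP; rewrite eqn_leq !(key _ _ _ _)//.
Qed.

Lemma xi_ray_alive (v : ray) n r :
  birth T (mkseq v n) <= r < death T (mkseq v n) ->
  xi_ray c x T Y v r = xi c x T Y (mkseq v n) r.
Proof.
move=> hr; apply: xget_unique.
  by exists (mkseq v n); split => //; exact: ray_prefix_mkseq.
move=> y [u [uv ur ->]]; rewrite -uv in ur *.
by rewrite (alive_unique ur hr).
Qed.

(** The integrand of [T_ray]. *)
Let speed (v : ray) (r : R) : R := expR (- alpha * xi_ray c x T Y v r).

Lemma integral_alive (v : ray) n s : let u := mkseq v n in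
  birth T u <= s -> s <= death T u ->
  measurable_fun `[birth T u, s[%classic (speed v) /\
  (\int[leb]_(r in `[birth T u, s[) (speed v r)%:E =
   ((expR (b * (zeta u + c * (s - birth T u))) - expR (b * zeta u)) / (b * c))%:E)%E.
Proof.
move=> u us su.
pose k r := expR (b * (zeta u + c * (r - birth T u))).
have vk r : r \in `[birth T u, s[%classic -> speed v r = k r.
  rewrite inE/= in_itv/= => /andP[ur rs].
  rewrite /speed (@xi_ray_alive v n) ?ur ?(lt_le_trans rs)// -bE.
  by rewrite /xi -/u.
have ck : continuous k.
  move=> r; apply: continuous_comp; last exact: continuous_expR.
  apply: (@continuousM _ R^o (fun=> b)); first exact: cst_continuous.
  apply: (@continuousD _ R^o _ (fun=> zeta u)); first exact: cst_continuous.
  apply: (@continuousM _ R^o (fun=> c)); first exact: cst_continuous.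
  apply: (@continuousB _ R^o _ id); last exact: cst_continuous.
  exact: cvg_id.
have mk : measurable_fun setT k by exact: continuous_measurable_fun.
split.
  apply: (eq_measurable_fun k); last exact: measurable_funTS.
  by move=> r hr; rewrite vk.
rewrite (eq_integral (fun r : measurableTypeR R => (k r)%:E)); last by move=> r hr; rewrite vk.
move: us; rewrite le_eqVlt => /predU1P[<-|us].
  by rewrite set_itvco0 integral_set0 !subrr mulr0 addr0 subrr mul0r.
rewrite integral_itv_bndo_bndc; last by apply/measurable_EFinP; exact: measurable_funTS.
have dk r : is_derive r (1 : R) (fun r => k r / (b * c)) (k r).
  rewrite /k; apply: is_derive_eq.
  rewrite /GRing.scale/=; field; rewrite !gt_eqF//.
rewrite (@continuous_FTC2 _ _ (fun r => k r / (b * c))) //.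
- rewrite -EFinB -mulrBl; congr ((_ - expR _) / _)%:E.
  by rewrite subrr mulr0 addr0.
- exact: continuous_subspaceT.
- have ckb : continuous (fun r => k r / (b * c)).
    by move=> r; apply: (@continuousM _ R^o k); [exact: ck|exact: cst_continuous].
  split.
  + by move=> r _; exact: ex_derive.
  + by apply: cvg_at_right_filter; exact: ckb.
  + by apply: cvg_at_left_filter; exact: ckb.
- by move=> r _; rewrite derive1E; exact: derive_val.
Qed.

Let integral_split (v : ray) (p q : R) : 0 <= p -> p <= q ->
  measurable_fun `[0, p[%classic (speed v) ->
  measurable_fun `[p, q[%classic (speed v) ->
  measurable_fun `[0, q[%classic (speed v) /\
  (\int[leb]_(r in `[0%R, q[) (speed v r)%:E =
   \int[leb]_(r in `[0%R, p[) (speed v r)%:E + \int[leb]_(r in `[p, q[) (speed v r)%:E)%E.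
Proof.
move=> p0 pq m1 m2.
have E : `[0, q[%classic = `[0, p[%classic `|` `[p, q[%classic.
  by rewrite -itv_bndbnd_setU// bnd_simp.
have m12 : measurable_fun (`[0, p[%classic `|` `[p, q[%classic) (speed v).
  by apply/measurable_funU.
split; first by rewrite E.
rewrite E ge0_integral_setU//.
- exact/measurable_EFinP.
- by move=> r _; rewrite lee_fin expR_ge0.
- apply/disj_setPS => r [] /=; rewrite !in_itv/= => /andP[_ rp] /andP[pr _].
  by have := lt_le_trans rp pr; rewrite ltxx.
Qed.

Let birth_ge0 u : 0 <= birth T u.
Proof. by apply: sumr_ge0 => i _; exact: ltW. Qed.

Lemma integral_ray (v : ray) n :
  measurable_fun `[0, birth T (mkseq v n)[%classic (speed v) /\
  (\int[leb]_(r in `[0%R, birth T (mkseq v n)[) (speed v r)%:E =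
   (clockTY (mkseq v n) / (b * c))%:E)%E.
Proof.
elim: n => [|n [IHm IHi]].
  rewrite /birth /clock !big_ord0 mul0r set_itvco0 integral_set0; split => //.
  exact: measurable_fun_set0.
rewrite mkseqS birth_rcons clock_rcons.
set u := mkseq v n in IHm IHi *.
have ud : birth T u <= death T u by rewrite /death lerDl ltW.
have [m2 i2] := @integral_alive v n (death T u) ud (lexx _).
have [m3 i3] := integral_split (birth_ge0 u) ud IHm m2.
split => //; rewrite i3 IHi i2 -EFinD -mulrDl.
by rewrite /death [birth T u + _]addrC addrK.
Qed.

Lemma T_ray_alive (v : ray) u s : ray_prefix u v ->
  birth T u <= s -> s <= death T u ->
  T_ray alpha c x T Y v s =
  ((clockTY u + (expR (b * (zeta u + c * (s - birth T u))) - expR (b * zeta u))) /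
    (b * c))%:E.
Proof.
rewrite /ray_prefix => uv us su; rewrite /T_ray.
have := integral_ray v (size u); rewrite uv => -[m1 i1].
have := @integral_alive v (size u) s; rewrite uv => /(_ us su)[m2 i2].
have [m3 i3] := integral_split (birth_ge0 u) us m1 m2.
rewrite -integral_itv_bndo_bndc; last exact/measurable_EFinP.
by rewrite i3 i1 i2 -EFinD -mulrDl.
Qed.

Lemma T_ray_le (v : ray) s s' : s <= s' ->
  (T_ray alpha c x T Y v s <= T_ray alpha c x T Y v s')%E.
Proof.
move=> ss'; apply: ge0_subset_integralW.
  by move=> r; rewrite lee_fin expR_ge0.
by move=> r /=; rewrite !in_itv/= => /andP[-> rs]; exact: le_trans ss'.
Qed.

Section fragment.
Variables (u : word) (q a : R).
(** The value of [e^(b xi)] for [u] at the self-similar time [q]: during the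
    life of [u] the rescaled clock and [e^(b xi)] increase by the same amount. *)
Let expxi := expR (b * zeta u) + b * c * q - clockTY u.
Hypotheses (uq : clockTY u < b * c * q) (expxi_ge1 : 1 <= expxi).
Hypothesis expxi_le : expxi <= expR (b * ln (1 + a)).
Hypothesis expxi_lt : expxi < expR (b * (zeta u + c * T u)).
Hypothesis a0 : 0 < a.

(** The natural time at which [e^(b xi)] takes this value. *)
Let s0 := birth T u + (ln expxi / b - zeta u) / c.

Let expxi_gt0 : 0 < expxi. Proof. exact: lt_le_trans expxi_ge1. Qed.

Let xi_s0 : zeta u + c * (s0 - birth T u) = ln expxi / b.
Proof.
rewrite /s0 [birth T u + _]addrC addrK mulrC divfK ?gt_eqF//; ring.
Qed.

Let expR_xi_s0 : expR (b * (zeta u + c * (s0 - birth T u))) = expxi.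
Proof. by rewrite xi_s0 mulrC divfK ?gt_eqF// lnK. Qed.

Let birth_s0 : birth T u < s0.
Proof.
rewrite /s0 ltrDl divr_gt0// subr_gt0 ltr_pdivlMr// mulrC -ltr_expR lnK//.
by rewrite /expxi -addrA ltrDl subr_gt0.
Qed.

Let s0_death : s0 < death T u.
Proof.
rewrite /s0 /death ltrD2l ltr_pdivrMr// ltrBlDl ltr_pdivrMr//.
by rewrite -ltr_expR lnK// mulrC [T u * c]mulrC.
Qed.

(** Before the birth of [u] the clock is too early and after its death it is too
    late; during its life the clock is injective.  This holds on every ray
    through [u], so the choices made by [S_ray] and [S_ind] are forced. *)
Let T_ray_s0 (v : ray) s : ray_prefix u v -> 0 <= s ->
  T_ray alpha c x T Y v s = q%:E <-> s = s0.
Proof.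
move=> uv s_ge0.
have ub : birth T u <= death T u by rewrite (le_trans (ltW birth_s0))// ltW.
split => [sq|->]; last first.
  rewrite (T_ray_alive uv (ltW birth_s0) (ltW s0_death)) expR_xi_s0.
  congr EFin; rewrite /expxi; field; by rewrite !gt_eqF.
have [sb|bs] := ltP s (birth T u).
  have := @T_ray_le v _ _ (ltW sb).
  rewrite sq (T_ray_alive uv (lexx _) ub) subrr mulr0 addr0 subrr addr0.
  by rewrite lee_fin ler_pdivlMr// mulrC leNgt uq.
have [sd|ds] := ltP s (death T u); last first.
  have := @T_ray_le v _ _ ds.
  rewrite sq (T_ray_alive uv ub (lexx _)) lee_fin ler_pdivrMr//.
  rewrite /death [birth T u + _]addrC addrK => h.
  by move: expxi_lt; rewrite /expxi; move: h; lra.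
move: sq; rewrite (T_ray_alive uv bs (ltW sd)) => -[] /(canRL (mulfVK _)).
rewrite gt_eqF// => /(_ isT) sq.
have : expR (b * (zeta u + c * (s - birth T u))) = expxi.
  by rewrite /expxi; move: sq; lra.
rewrite -expR_xi_s0 => /expR_inj /(mulfI (lt0r_neq0 b0)) /addrI.
by move=> /(mulfI (lt0r_neq0 c0)) /subIr.
Qed.

Let S_ray_s0 (v : ray) : ray_prefix u v -> S_ray alpha c x T Y v q = s0%:E.
Proof.
have s0_ge0 : 0 <= s0 by rewrite (le_trans (birth_ge0 u))// ltW.
move=> uv; apply: xget_unique.
  by exists s0 => //; split => //; exact/(T_ray_s0 uv).
by move=> _ [s [s_ge0 sq] <-]; rewrite (iffLR (T_ray_s0 uv s_ge0)).
Qed.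

(** The hypotheses say that [e^(b xi)] would have the value [expxi] at time [q],
    that this value is reached strictly between the birth and the death of [u],
    and that it corresponds to a size in [[1, 1 + a]]. *)
Lemma fragment_in : fragments_in alpha c x T Y q `[1, 1 + a]%classic u.
Proof.
pose v : ray := nth Lft u.
have uv : ray_prefix u v by rewrite /ray_prefix mkseq_nth.
have alive : ((birth T u)%:E <= s0%:E < (death T u)%:E)%E.
  by rewrite lee_fin lte_fin s0_death ltW.
have SE : S_ind alpha c x T Y u q = s0%:E.
  apply: xget_unique; first by exists v; rewrite S_ray_s0.
  by move=> _ [v' [uv' _ ->]]; exact: S_ray_s0.
split.
- by exists v; rewrite S_ray_s0.
- by rewrite SE.
- rewrite SE /= /xi xi_s0 in_itv/=; apply/andP; split.
    by rewrite -[leLHS]expR0 ler_expR divr_ge0 ?(ltW b0)// ln_ge0.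
  rewrite -[leRHS]lnK ?posrE ?addr_gt0// ler_expR ler_pdivrMr// mulrC.
  by rewrite -ler_expR lnK.
Qed.

End fragment.

End rays.

(** * The left spine and its branches *)

Definition spine (n : nat) : word := nseq n Lft.

(** The [k]-th individual on the ray that leaves the spine at its [n]-th vertex
    through the larger child and takes only larger children afterwards. *)
Definition branch (n k : nat) : word := spine n ++ nseq k.+1 Rgt.

Lemma nseq_rcons (A : Type) n (y : A) : nseq n.+1 y = rcons (nseq n y) y.
Proof. by elim: n => //= n ->. Qed.

Lemma spineS n : spine n.+1 = rcons (spine n) Lft.
Proof. exact: nseq_rcons. Qed.

Lemma branch0 n : branch n 0 = rcons (spine n) Rgt.
Proof. by rewrite /branch cats1. Qed.

Lemma branchS n k : branch n k.+1 = rcons (branch n k) Rgt.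
Proof. by rewrite /branch nseq_rcons -rcons_cat. Qed.

Lemma size_branch n k : size (branch n k) = (n + k.+1)%N.
Proof. by rewrite size_cat !size_nseq. Qed.

Section paths.
Context (R : realType) (d : measure_display) (Omega : measurableType d).
Context (P : probability Omega R) (T Y : word -> Omega -> R).
Hypothesis TY : driving_noise P T Y.
Variables (b c x : R).
Hypotheses (b0 : 0 < b) (c0 : 0 < c).
Local Notation without := (without (noise T Y)).

Definition zeta_at (u : word) (w : Omega) : R := zeta c x (T^~ w) (Y^~ w) u.
Definition clock_at (u : word) (w : Omega) : R := clock b c x (T^~ w) (Y^~ w) u.

Lemma clock_at_ge0 u w : 0 <= clock_at u w.
Proof.
apply: sumr_ge0 => i _; rewrite subr_ge0 ler_expR ler_pM2l// lerDl.
by rewrite mulr_ge0 ?(ltW c0)// ltW// (T_gt0 TY).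
Qed.

(** The birth position of [u] depends only on strictly shorter words. *)
Lemma measurable_zeta_without j u : (size u <= size (site_word j))%N ->
  measurable_fun [set: without j] (zeta_at u : without j -> R).
Proof.
move=> uj; apply: measurable_funD => //; apply: measurable_sum => i.
have h (f : word -> site) (hf : forall u, site_word (f u) = u) : f (take i u) != j.
  apply: contraTneq uj => <-; rewrite hf size_takel ?(ltnW (ltn_ord i))//.
  by rewrite -ltnNge ltn_ord.
apply: measurable_funD.
  apply: measurableT_comp; first exact: measurable_ln.
  have mY : measurable_fun [set: without j] (Y (take i u) : without j -> R).
    by apply: measurable_without_Y; exact: (h inr).
  by case: (nth Lft u i) => //=; exact: measurable_funB.
apply: measurable_funM => //; apply: measurable_without_T; exact: (h inl).
Qed.

Lemma measurable_zeta_at u : measurable_fun setT (zeta_at u).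
Proof.
apply: (measurable_from_without TY (j := inl u)).
exact: measurable_zeta_without.
Qed.

Lemma measurable_exp_zeta u : measurable_fun setT (fun w => expR (b * zeta_at u w)).
Proof.
apply: measurableT_comp; first exact: measurable_expR.
by apply: measurable_funM => //; exact: measurable_zeta_at.
Qed.

Lemma measurable_exp_death u :
  measurable_fun setT (fun w => expR (b * (zeta_at u w + c * T u w))).
Proof.
apply: measurableT_comp; first exact: measurable_expR.
apply: measurable_funM => //; apply: measurable_funD; first exact: measurable_zeta_at.
by apply: measurable_funM => //; exact: (measurable_T TY).
Qed.

Lemma measurable_clock_at u : measurable_fun setT (clock_at u).
Proof.
apply: measurable_sum => i; apply: measurable_funB; last exact: measurable_exp_zeta.
exact: measurable_exp_death.
Qed.

Section one_branch.
Variable n : nat.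

Definition start (w : Omega) : R := Num.min 1 (expR (b * zeta_at (branch n 0) w)).

Local Notation lev := (level T Y b (b * c) (branch n) start).
Local Notation grow := (grown T Y b (b * c) (branch n) start).

Lemma start_gt0 w : 0 < start w.
Proof. by rewrite lt_min ltr01 expR_gt0. Qed.

Lemma start_le1 w : start w <= 1.
Proof. by rewrite ge_min lexx. Qed.

Lemma measurable_start j : (size (branch n 0) <= size (site_word j))%N ->
  measurable_fun [set: without j] (start : without j -> R).
Proof.
move=> nj; apply: measurable_minr => //.
apply: measurableT_comp; first exact: measurable_expR.
by apply: measurable_funM => //; exact: measurable_zeta_without.
Qed.

Lemma size_branchS k : size (branch n k.+1) = (size (branch n k)).+1.
Proof. by rewrite branchS size_rcons. Qed.

Let bc0 : 0 < b * c. Proof. by rewrite mulr_gt0. Qed.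

Lemma grown_lt1_pred k w : lev k.+1 w < 1 -> grow k w < 1.
Proof. by rewrite levelS; case: ifP => //; rewrite ltxx. Qed.

Lemma level_lt1_pred k w : lev k.+1 w < 1 -> lev k w < 1.
Proof.
move=> /grown_lt1_pred; apply: le_lt_trans.
have := @level_le_grown _ _ _ _ _ _ TY b _ (branch n) _ b0 bc0 start_gt0 start_le1 k w.
by rewrite le_min => /andP[].
Qed.

(** Before the first passage at 1, the Lyapunov process is [e^(b xi)]. *)
Lemma level_zeta k w : zeta_at (branch n 0) w < 0 -> lev k w < 1 ->
  lev k w = expR (b * zeta_at (branch n k) w).
Proof.
move=> z0; elim: k => [_|k IH hk].
  rewrite /= /start minElt ifF//; apply/negbTE; rewrite -leNgt.
  by rewrite -[leRHS]expR0 ler_expR pmulr_rle0// ltW.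
rewrite levelS (grown_lt1_pred hk) /grown IH; last exact: level_lt1_pred hk.
rewrite -!expRD; congr expR; rewrite branchS /zeta_at zeta_Rgt; ring.
Qed.

Lemma grown_zeta k w : zeta_at (branch n 0) w < 0 -> lev k w < 1 ->
  grow k w = expR (b * (zeta_at (branch n k) w + c * T (branch n k) w)).
Proof.
by move=> z0 hk; rewrite /grown level_zeta// -expRD; congr expR; ring.
Qed.

(** Before the first passage, the clock advances exactly by the growth whose mean
    is bounded in [integral_growth_sum]. *)
Lemma clock_branch k w : zeta_at (branch n 0) w < 0 -> lev k w < 1 ->
  clock_at (branch n k) w = clock_at (branch n 0) w +
    \sum_(j < k) (Num.min 1 (grow j w) - lev j w).
Proof.
move=> z0; elim: k => [_|k IH hk]; first by rewrite big_ord0 addr0.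
have hk' := level_lt1_pred hk.
rewrite big_ord_recr/= addrA -IH// branchS /clock_at clock_rcons; congr (_ + (_ - _)).
  rewrite minElt ifF; first by rewrite grown_zeta.
  by apply/negbTE; rewrite -leNgt ltW// grown_lt1_pred.
by rewrite level_zeta.
Qed.

End one_branch.

End paths.

(** * Almost sure behaviour of the branches *)

Section almost_sure.
Context (R : realType) (d : measure_display) (Omega : measurableType d).
Context (P : probability Omega R) (T Y : word -> Omega -> R).
Hypothesis TY : driving_noise P T Y.
Variables (b c x : R).
Hypotheses (b0 : 0 < b) (c0 : 0 < c).
Hypothesis EL : (\int[P]_w (ln (1 - Y [::] w))%:E + c%:E < 0)%E.
Hypothesis ER : (0 < \int[P]_w (ln (Y [::] w))%:E + c%:E)%E.
Local Notation zetaw := (zeta_at T Y c x).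
Local Notation clockw := (clock_at T Y b c x).
Local Notation lev n := (level T Y b (b * c) (branch n) (start T Y b c x n)).
Local Notation grow n := (grown T Y b (b * c) (branch n) (start T Y b c x n)).

Let bc0 : 0 < b * c. Proof. by rewrite mulr_gt0. Qed.

Let Y_gt0 u w : 0 < Y u w.
Proof. by apply: lt_le_trans (Y_ge TY u w); rewrite invr_gt0. Qed.

Let mlnY : measurable_fun setT (fun w => ln (Y [::] w)).
Proof. by apply: measurableT_comp => //; exact: (measurable_Y TY). Qed.

Let mlnY1 : measurable_fun setT (fun w => ln (1 - Y [::] w)).
Proof.
apply: measurableT_comp => //; apply: measurable_funB => //; exact: (measurable_Y TY).
Qed.

Let lnY_le0 u w : ln (Y u w) <= 0.
Proof. by rewrite ln_le0// ltW// (Y_lt1 TY). Qed.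

Let lnY_ge w : - ln 2 <= ln (Y [::] w).
Proof. by rewrite -lnV ?posrE// ler_ln ?posrE ?invr_gt0// (Y_ge TY). Qed.

Let integrable_lnY : P.-integrable setT (fun w => (ln (Y [::] w))%:E).
Proof.
apply/integrableP; split; first exact/measurable_EFinP.
apply: (@le_lt_trans _ _ (\int[P]_w (ln 2)%:E)%E); last first.
  by rewrite integral_cst_probability ltry.
apply: ge0_le_integral => //.
- by apply/measurable_EFinP; exact: measurableT_comp.
- by move=> w _; rewrite lee_fin ler0_norm// lerNl lnY_ge.
Qed.

(** From [1 - Y^b <= - b * ln Y]; this is the drift condition of the Lyapunov
    function. *)
Lemma mean_ratio_power : exists2 m : R,
  (\int[P]_w (expR (b * ln (Y [::] w)))%:E = m%:E)%E & 1 - m < b * c.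
Proof.
have mE : measurable_fun setT (fun w => expR (b * ln (Y [::] w))).
  apply: measurableT_comp; first exact: measurable_expR.
  exact: measurable_funM.
have E_le1 w : expR (b * ln (Y [::] w)) <= 1.
  by rewrite -[leRHS]expR0 ler_expR pmulr_rle0.
have iE : P.-integrable setT (fun w => (expR (b * ln (Y [::] w)))%:E).
  apply/integrableP; split; first exact/measurable_EFinP.
  apply: (@le_lt_trans _ _ (\int[P]_w 1%:E)%E); last first.
    by rewrite integral_cst_probability ltry.
  apply: ge0_le_integral => //.
  - by apply/measurable_EFinP; exact: measurableT_comp.
  - by move=> w _; rewrite lee_fin ger0_norm ?expR_ge0.
have fE := integrable_fin_num measurableT iE.
have fL := integrable_fin_num measurableT integrable_lnY.
exists (fine (\int[P]_w (expR (b * ln (Y [::] w)))%:E)); first by rewrite fineK.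
have : (1%:E + b%:E * \int[P]_w (ln (Y [::] w))%:E <=
        \int[P]_w (expR (b * ln (Y [::] w)))%:E)%E.
  rewrite -[X in (X + _)%E](@integral_cst_probability _ _ _ P 1) -integralZl//.
  rewrite -integralD//; last 2 first.
  - exact: finite_measure_integrable_cst.
  - exact: integrableZl.
  apply: le_integral => //.
    apply: integrableD => //; first exact: finite_measure_integrable_cst.
    exact: integrableZl.
  by move=> w _; rewrite -EFinM -EFinD lee_fin expR_ge1Dx.
move: ER; rewrite -(fineK fE) -(fineK fL) -EFinM -!EFinD lee_fin lte_fin.
set L := fine _; set m := fine _ => Lc h.
have : 0 < b * (L + c) by rewrite mulr_gt0.
rewrite mulrDr -ltrBlDl sub0r => /(le_lt_trans _); apply.
by rewrite lerBlDr addrC lerBrDr.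
Qed.

(** [e^(theta (xi - x))] is summable along the spine for some [theta < b], hence
    so is [e^(b xi)], which bounds the advance of the clock; the terms also tend
    to 0, which puts the starting points of the branches below 0. *)
Lemma ae_spine : {ae P, forall w, exists m N0 : nat, forall n, (N0 <= n)%N ->
  zetaw (branch n 0) w < 0 /\ clockw (branch n 0) w <= m%:R}.
Proof.
have W0 w : ln (1 - Y [::] w) <= 0.
  by rewrite ln_le0// gerBl ltW.
have [th [th0 thb hth]] := small_exponent mlnY1 W0 EL b0.
pose phi y := expR (th * ln (1 - y)).
have phi0 y : 0 <= phi y by exact: expR_ge0.
have mphi : measurable_fun setT phi.
  apply: measurableT_comp; first exact: measurable_expR.
  by apply: measurable_funM => //; apply: measurableT_comp => //; exact: measurable_funB.
have q0 : (0 <= \int[P]_w (phi (Y [::] w))%:E)%E.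
  by apply: integral_ge0 => w _; rewrite lee_fin.
have qf : (\int[P]_w (phi (Y [::] w))%:E)%E \is a fin_num.
  by rewrite ge0_fin_numE// (lt_trans hth)// ltry.
have qE := esym (fineK qf); set q := fine _ in qE.
have ql : q < 1 - th * c by rewrite -lte_fin -qE.
have l1 : th * c < 1.
  by rewrite -subr_gt0 (le_lt_trans _ ql)// fine_ge0.
have sz k : size (spine k.+1) = (size (spine k)).+1 by rewrite !size_nseq.
have := weight_summable TY l1 mphi phi0 sz qE ql; apply: filterS => w [M hM].
set D := weight T Y _ phi _ in hM.
have D0 k : 0 <= D k w by exact: weight_ge0.
pose y k := zetaw (spine k) w + c * T (spine k) w - x.
have DE k : D k w = expR (th * y k).
  elim: k => [|k IH]; rewrite /D/= -/D.
    by rewrite /y /zeta_at zeta_nil; congr expR; ring.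
  rewrite IH /phi -!expRD; congr expR.
  rewrite /y -[Lft :: _]/(spine k.+1) spineS /zeta_at zeta_Lft; ring.
have DM k : D k w <= M.
  apply: le_trans (hM k.+1); rewrite big_ord_recr/= lerDr.
  by apply: sumr_ge0 => i _; exact: D0.
have M0 : 0 < M by apply: lt_le_trans (DM 0); rewrite DE expR_gt0.
pose C := expR (b * x) * expR ((b - th) * (ln M / th)).
have C0 : 0 <= C by rewrite mulr_ge0 ?expR_ge0.
(* as [y k] is bounded above and [th < b], the factor [expR ((b - th) * y k)]
   is bounded *)
have expC k : expR (b * (zetaw (spine k) w + c * T (spine k) w)) <= C * D k w.
  have -> : b * (zetaw (spine k) w + c * T (spine k) w) =
      b * x + (b - th) * y k + th * y k by rewrite /y; ring.
  rewrite DE !expRD ler_pM2r ?expR_gt0// ler_pM2l ?expR_gt0// ler_expR.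
  rewrite ler_pM2l ?subr_gt0// ler_pdivlMr// mulrC -ler_expR lnK ?posrE//.
  by rewrite -DE.
have clockC n l : clockw (rcons (spine n) l) w <= C * \sum_(k < n.+1) D k w.
  elim: n l => [|n IH] l; rewrite /clock_at clock_rcons big_ord_recr [C * _]mulrDr.
    rewrite big_ord0 mulr0 /clock big_ord0 lerD2l.
    by apply: le_trans (expC 0); rewrite gerBl expR_ge0.
  apply: lerD; first by rewrite spineS; exact: IH.
  by apply: le_trans (expC n.+1); rewrite gerBl expR_ge0.
have [N hN] := bounded_series_small D0 hM (expR_gt0 (- (th * x))).
exists (Num.truncn (C * M)).+1, N => n Nn; rewrite branch0; split.
  have := hN n Nn; rewrite DE ltr_expR -mulrN ltr_pM2l// /y => h.
  rewrite /zeta_at zeta_Rgt -/(zeta_at _ _ _ _ _ _).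
  have := lnY_le0 (spine n) w; move: h; lra.
rewrite (le_trans (clockC _ _))// (le_trans _ (ltW (truncnS_gt _)))//.
by rewrite ler_wpM2l.
Qed.

(** A branch that never crosses 0 would keep [e^(- theta xi)] at least 1, although
    the latter is summable along the branch. *)
Lemma ae_crossing n : {ae P, forall w, zetaw (branch n 0) w < 0 ->
  exists k, lev n k w < 1 <= grow n k w}.
Proof.
have mW : measurable_fun setT (fun w => - ln (Y [::] w)).
  by apply: measurableT_comp.
have W2 w : - ln (Y [::] w) <= ln 2 by rewrite lerNl lnY_ge.
have EW : (\int[P]_w (- ln (Y [::] w))%:E + (- c)%:E < 0)%E.
  under eq_integral do rewrite EFinN.
  rewrite integralN; last first.
    exact: integrable_add_def.
  move: ER; rewrite -(fineK (integrable_fin_num measurableT integrable_lnY)).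
  by rewrite -EFinN -!EFinD !lte_fin; lra.
have [th [th0 _ hth]] := small_exponent mW W2 EW ltr01.
pose phi y := expR (th * - ln y).
have phi0 y : 0 <= phi y by exact: expR_ge0.
have mphi : measurable_fun setT phi.
  apply: measurableT_comp; first exact: measurable_expR.
  by apply: measurable_funM => //; apply: measurableT_comp.
have q0 : (0 <= \int[P]_w (phi (Y [::] w))%:E)%E.
  by apply: integral_ge0 => w _; rewrite lee_fin.
have qf : (\int[P]_w (phi (Y [::] w))%:E)%E \is a fin_num.
  by rewrite ge0_fin_numE// (lt_trans hth)// ltry.
have qE := esym (fineK qf); set q := fine _ in qE.
have ql : q < 1 - th * - c by rewrite -lte_fin -qE.
have l1 : th * - c < 1.
  by rewrite -subr_gt0 (le_lt_trans _ ql)// fine_ge0.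
have := weight_summable TY l1 mphi phi0 (size_branchS n) qE ql.
apply: filterS => w [M hM] z0; set D := weight T Y _ phi _ in hM.
have D0 k : 0 <= D k w by exact: weight_ge0.
have DE k : D k w = expR (- th * (zetaw (branch n k) w + c * T (branch n k) w -
    zetaw (branch n 0) w)).
  elim: k => [|k IH]; rewrite /D/= -/D.
    by congr expR; ring.
  rewrite IH /phi -!expRD; congr expR.
  rewrite branchS /zeta_at zeta_Rgt; ring.
apply: contrapT => /forallNP nocross.
have no k : lev n k w < 1 -> grow n k w < 1.
  by move=> hk; have := nocross k; rewrite hk/= => /negP; rewrite -ltNge.
have lev1 k : lev n k w < 1.
  elim: k => [|k IH].
    by rewrite /= /start gt_min -[X in _ || (_ < X)]expR0 ltr_expR pmulr_rlt0// z0 orbT.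
  rewrite levelS (no _ IH); apply: le_lt_trans (no _ IH).
  rewrite ler_piMr ?(ltW (grown_gt0 _ _ _ _ _ (start_gt0 _ _ _ _ _ _) _ _))//.
  by rewrite -[leRHS]expR0 ler_expR pmulr_rle0.
have [N hN] := bounded_series_small D0 hM (expR_gt0 (th * zetaw (branch n 0) w)).
have := hN N (leqnn N); rewrite DE ltr_expR mulNr -mulrN ltr_pM2l//.
have := no N (lev1 N); rewrite (grown_zeta TY b0 c0 z0 (lev1 N)).
rewrite -[X in _ < X]expR0 ltr_expR pmulr_rlt0//; lra.
Qed.

(** Starting below size 1, at a bounded time. *)
Definition tame_start (m n : nat) : set Omega :=
  [set w | (zetaw (branch n 0) w < 0) && (clockw (branch n 0) w <= m%:R)].

(** [u] is born below size 1 at a bounded time, and dies clearly above size 1; the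
    single index [M] bounds both the time and the inverse of the margin, which
    makes the good events countably many. *)
Definition good_word (M : nat) (u : word) (w : Omega) : bool :=
  [&& zetaw u w < 0,
      1 + M.+1%:R^-1 <= expR (b * (zetaw u w + c * T u w)) &
      clockw u w <= M%:R].

Definition good_branch (M n : nat) : set Omega :=
  [set w | exists k, good_word M (branch n k) w].

Lemma measurable_tame_start m n : measurable (tame_start m n).
Proof.
apply: measurable_bool_set; apply: measurable_and.
- by apply: measurable_fun_ltr => //; exact: (measurable_zeta_at TY).
- by apply: measurable_fun_ler => //; exact: (measurable_clock_at TY).
Qed.

Lemma measurable_good_branch M n : measurable (good_branch M n).
Proof.
rewrite (_ : good_branch M n = \bigcup_k [set w | good_word M (branch n k) w]).
  apply: bigcupT_measurable => k; apply: measurable_bool_set.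
  apply: measurable_and; last apply: measurable_and.
  - by apply: measurable_fun_ltr => //; exact: (measurable_zeta_at TY).
  - by apply: measurable_fun_ler => //; exact: (measurable_exp_death TY).
  - by apply: measurable_fun_ler => //; exact: (measurable_clock_at TY).
by apply/seteqP; split => [w [k hk]|w [k _ hk]]; exists k.
Qed.

(** A branch with a tame start crosses size 1.  If the crossing individual is not
    good, then either it overshoots by less than [M.+1^-1] or the clock has
    advanced by more than [M - m = K.+1] since the start.  The bounds on both
    events depend neither on the branch nor on its starting point. *)
Lemma miss_bound : exists C : R, forall m K n,
  (P (tame_start m n `\` good_branch (m + K.+1) n) <= (C / K.+1%:R)%:E)%E.
Proof.
have [q qE ql] := mean_ratio_power.
pose C1 := b * c / (b * c + q - 1).
exists (2 / (b * c) + C1) => m K n; set M := (m + K.+1)%N.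
have st0 := start_gt0 T Y b c x n; have st1 := start_le1 T Y b c x n.
have mst := @measurable_start _ _ _ T Y b c x n.
have K0 : (0 : R) < K.+1%:R by rewrite ltr0n.
pose e : R := M.+1%:R^-1; have e0 : 0 < e by rewrite invr_gt0 ltr0n.
pose over := overshoot T Y b (b * c) (branch n) (start T Y b c x n) e.
pose grw k w := Num.min 1 (grow n k w) - lev n k w.
have [|k w|j||mO PO] := @markov_partial_sums _ _ _ P over (e / (b * c)) 2^-1.
- move=> k; apply: (@measurable_overshoot _ _ _ P T Y TY b (b * c) (branch n)) => //.
  exact: size_branchS.
- by rewrite /over /overshoot; case: ifP.
- exact: (integral_overshoot_sum TY b0 bc0 (size_branchS n) st0 st1 mst).
- by rewrite invr_gt0.
have [|k w|j||mG PG] := @markov_partial_sums _ _ _ P grw C1 K.+1%:R.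
- by apply: (@measurable_growth _ _ _ P T Y TY b (b * c) (branch n)) => //; exact: size_branchS.
- by rewrite /grw subr_ge0 (level_le_grown TY _ b0 bc0).
- exact: (integral_growth_sum TY b0 bc0 (size_branchS n) st0 st1 mst qE ql).
- by [].
have [N [mN N0 hN]] := ae_crossing n.
set EO := [set w | _] in mO PO; set EG := [set w | _] in mG PG.
have sub : tame_start m n `\` good_branch M n `<=` N `|` (EO `|` EG).
  move=> w [/andP[z0 cm] ng].
  have [Nw|nNw] := pselect (N w); first by left.
  have [k /andP[lk gk]] : exists k, lev n k w < 1 <= grow n k w.
    by apply: contrapT => h; apply: nNw; apply: hN => /(_ z0).
  right; have zk : zetaw (branch n k) w < 0.
    rewrite -(pmulr_rlt0 _ b0) -expR_lt1 -(level_zeta TY b0 c0 z0 lk)//.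
  (* the number of overshoots is an integer, so 1/2 is as good a threshold as 1 *)
  have [h|h] := ltP (grow n k w) (1 + e).
    left; exists k.+1; rewrite big_ord_recr/=.
    rewrite {2}/over /overshoot lk gk h/=.
    apply: (@lt_le_trans _ _ 1); last first.
      by rewrite lerDr sumr_ge0// => i _; rewrite /over /overshoot; case: ifP.
    by rewrite invf_lt1// ltr1n.
  right; exists k; rewrite ltNge; apply/negP => gs; apply: ng; exists k.
  apply/and3P; split => //; first by rewrite -(grown_zeta TY b0 c0 z0 lk).
  rewrite (clock_branch TY b0 c0 z0 lk) natrD; exact: lerD.
apply: (@le_trans _ _ (P N + (P EO + P EG)))%E.
  have mU : measurable (EO `|` EG) by exact: measurableU.
  apply: (@le_trans _ _ (P (N `|` (EO `|` EG)))).
    apply: le_measure => //; rewrite inE; last exact: measurableU.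
    by apply: measurableD; [exact: measurable_tame_start|exact: measurable_good_branch].
  apply: (le_trans (measureU2 _ _ _)) => //; apply: leeD2l.
  exact: measureU2.
rewrite N0 add0e; apply: (le_trans (leeD PO PG)).
rewrite -EFinD lee_fin mulrDl lerD2r invrK mulrC.
rewrite mulrA mulrAC ler_pM2l ?divr_gt0// lef_pV2 ?posrE ?ltr0n//.
by rewrite ler_nat leqW// leq_addl.
Qed.

(** On the event that all branches from [N0] on have a tame start, and that for
    each [M] only finitely many are good, all branches from some rank on miss
    the level [m + K.+1], for every [K].  By [miss_bound] this has
    probability 0. *)
Lemma ae_infinitely_many_good : {ae P, forall w, exists M : nat,
  forall N, exists2 n, (N <= n)%N & good_branch M n w}.
Proof.
have [C hC] := miss_bound.
pose miss m K n := tame_start m n `\` good_branch (m + K.+1) n.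
have mmiss m K n : measurable (miss m K n).
  by apply: measurableD; [exact: measurable_tame_start|exact: measurable_good_branch].
have null m N0 : {ae P, forall w, (forall n, (N0 <= n)%N -> tame_start m n w) ->
    exists M : nat, forall N, exists2 n, (N <= n)%N & good_branch M n w}.
  pose F K N := \bigcap_(n in [set n | (maxn N N0 <= n)%N]) miss m K n.
  have mF K N : measurable (F K N) by apply: bigcap_measurableType => n _.
  have PF K : (P (\bigcup_N F K N) <= (C / K.+1%:R)%:E)%E.
    apply: probability_bigcup_le => //.
      move=> N N' NN'; apply/subsetPset => w hw n /= hn; apply: hw => /=.
      by rewrite (leq_trans _ hn)// geq_max (leq_trans NN') ?leq_maxl// leq_maxr.
    move=> N; apply: le_trans (hC m K (maxn N N0)).
    by apply: le_measure; rewrite ?inE//; [exact: mmiss|move=> w; apply => /=].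
  exists (\bigcap_K \bigcup_N F K N); split.
  - by apply: bigcapT_measurable => K; exact: bigcupT_measurable.
  - apply/eqP; rewrite eq_le measure_ge0 andbT; apply/lee_addgt0Pr => e e0.
    rewrite add0e; pose K := Num.truncn (C / e).
    apply: (@le_trans _ _ (C / K.+1%:R)%:E); last first.
      rewrite lee_fin ler_pdivrMr ?ltr0n// mulrC -ler_pdivrMr//.
      by rewrite ltW// truncnS_gt.
    apply: le_trans (PF K); apply: le_measure; rewrite ?inE.
    + by apply: bigcapT_measurable => K'; exact: bigcupT_measurable.
    + exact: bigcupT_measurable.
    + by move=> w; exact.
  - move=> w /= /not_implyP[late /forallNP nogood] K _.
    have /existsNP[N hN] := nogood (m + K.+1)%N.
    exists N => // n /= hn; split; first by apply: late; rewrite (leq_trans _ hn)// leq_maxr.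
    by move=> g; apply: hN; exists n => //; rewrite (leq_trans _ hn)// leq_maxl.
have null' := ae_foralln (fun m => ae_foralln (null m)).
apply: filterS2 null' ae_spine => w h [m [N0 hN0]]; apply: (h m N0) => n Nn.
by apply/andP; exact: hN0.
Qed.

End almost_sure.

(** * Choice of the random time *)

Lemma infinite_words (A : set word) :
  (forall N, exists2 u, A u & (N <= size u)%N) -> infinite_set A.
Proof.
move=> hA /finite_seqP[s sA].
have [u Au] := hA (\max_(v <- s) size v).+1.
have us : u \in s by rewrite sA in Au.
by rewrite ltnNge (leq_bigmax_seq (F := size)).
Qed.

Lemma eventually_below (Q : nat -> nat -> Prop) I :
  (forall i, (i <= I)%N -> exists N, forall n, (N <= n)%N -> Q i n) ->
  exists N, forall i n, (i <= I)%N -> (N <= n)%N -> Q i n.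
Proof.
elim: I => [|I IH] h.
  have [N hN] := h 0 (leqnn _); exists N => i n.
  by rewrite leqn0 => /eqP ->; exact: hN.
have [N hN] := IH (fun i iI => h i (leqW iI)).
have [N' hN'] := h I.+1 (leqnn _).
exists (maxn N N') => i n; rewrite geq_max leq_eqVlt => /predU1P[->|iI] /andP[Nn N'n].
  exact: hN'.
exact: hN.
Qed.

Section selection.
Context (R : realType) (d : measure_display) (Omega : measurableType d).
Context (P : probability Omega R).

(** The first index [j] whose event occurs selects the value [q j]; a function
    that is constant on each piece of a countable measurable partition is
    measurable. *)
Lemma measurable_selection (q : nat -> R) (E : (set Omega)^nat) :
  (forall j, 0 <= q j) -> (forall j, measurable (E j)) ->
  exists sigma : Omega -> R, [/\ measurable_fun setT sigma,
    forall w, 0 <= sigma w &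
    forall w, (exists j, E j w) -> exists2 j, E j w & sigma w = q j].
Proof.
move=> q0 mE.
pose sigma w := xget 0 [set y | exists2 j, seqDU E j w & y = q j].
have sE j w : seqDU E j w -> sigma w = q j.
  move=> jw; apply: xget_unique; first by exists j.
  move=> _ [i iw ->]; congr (q _).
  by apply: (@trivIset_seqDU _ E i j I I); exists w.
have s0 w : ~ (\bigcup_j E j) w -> sigma w = 0.
  move=> h; apply: xgetPN => y [j [jw _] _]; apply: h; by exists j.
have mF : forall j, measurable (seqDU E j) by exact: seqDU_measurable.
have UE : \bigcup_j E j = \bigcup_j seqDU E j by exact: seqDU_bigcup_eq.
exists sigma; split.
- move=> _ A mA; rewrite setTI.
  have -> : sigma @^-1` A = (\bigcup_j (if q j \in A then seqDU E j else set0)) `|`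
      (if 0 \in A then ~` (\bigcup_j E j) else set0).
    apply/seteqP; split => [w /= Aw|w [[j _]|]].
    + have [|nE] := pselect ((\bigcup_j E j) w).
        rewrite UE => -[j _ jw]; left; exists j => //.
        by rewrite -(sE _ _ jw) mem_set.
      by right; rewrite -(s0 _ nE) mem_set.
    + by case: ifPn => //; rewrite inE => Aq jw; rewrite /preimage/= (sE _ _ jw).
    + by case: ifPn => //; rewrite inE => A0 nE; rewrite /preimage/= s0.
  apply: measurableU; last first.
    by case: ifP => // _; apply: measurableC; exact: bigcupT_measurable.
  by apply: bigcupT_measurable => j; case: ifP.
- move=> w; have [|nE] := pselect ((\bigcup_j E j) w); last by rewrite s0.
  by rewrite UE => -[j _ jw]; rewrite (sE _ _ jw).
- move=> w [j jw]; have : (\bigcup_j E j) w by exists j.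
  by rewrite UE => -[i _ iw]; exists i; [case: iw|exact: sE].
Qed.

End selection.

Section random_time.
Context (R : realType) (d : measure_display) (Omega : measurableType d).
Context (P : probability Omega R) (T Y : word -> Omega -> R).
Hypothesis TY : driving_noise P T Y.
Variables (alpha c x a : R).
Hypotheses (alpha0 : alpha < 0) (c0 : 0 < c) (a0 : 0 < a).
Hypothesis EL : (\int[P]_w (ln (1 - Y [::] w))%:E + c%:E < 0)%E.
Hypothesis ER : (0 < \int[P]_w (ln (Y [::] w))%:E + c%:E)%E.

Let b := - alpha.
Let b0 : 0 < b. Proof. by rewrite oppr_gt0. Qed.
Let bc0 : 0 < b * c. Proof. by rewrite mulr_gt0. Qed.
Local Notation zetaw := (zeta_at T Y c x).
Local Notation clockw := (clock_at T Y b c x).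

Definition grown_at (q : R) (u : word) (w : Omega) : R :=
  expR (b * zetaw u w) + b * c * q - clockw u w.

(** The conditions of [fragment_in]. *)
Definition in_window (q : R) (u : word) (w : Omega) : bool :=
  [&& clockw u w < b * c * q, 1 <= grown_at q u w,
      grown_at q u w <= expR (b * ln (1 + a)) &
      grown_at q u w < expR (b * (zetaw u w + c * T u w))].

Definition hits_often (q : R) : set Omega :=
  [set w | forall N, exists2 n, (N <= n)%N & exists k, in_window q (branch n k) w].

Lemma measurable_hits_often q : measurable (hits_often q).
Proof.
have mg u : measurable_fun setT (grown_at q u).
  apply: measurable_funB; last exact: (measurable_clock_at TY).
  by apply: measurable_funD => //; exact: (measurable_exp_zeta TY).
rewrite (_ : hits_often q = \bigcap_N \bigcup_(n in [set n | (N <= n)%N])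
    \bigcup_k [set w | in_window q (branch n k) w]).
  apply: bigcapT_measurable => N; apply: bigcup_measurable => n _.
  apply: bigcupT_measurable => k; apply: measurable_bool_set.
  apply: measurable_and; last (apply: measurable_and; last apply: measurable_and).
  - by apply: measurable_fun_ltr => //; exact: (measurable_clock_at TY).
  - exact: measurable_fun_ler.
  - exact: measurable_fun_ler.
  - by apply: measurable_fun_ltr => //; exact: (measurable_exp_death TY).
apply/seteqP; split => [w h N _|w h N].
  by have [n Nn [k hk]] := h N; exists n => //; exists k.
by have [n Nn [k _ hk]] := h N I; exists n => //; exists k.
Qed.

Lemma hits_often_fragments q w : hits_often q w ->
  infinite_set (fragments_in alpha c x (T^~ w) (Y^~ w) q `[1, 1 + a]%classic).
Proof.
move=> h; apply: infinite_words => N.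
have [n Nn [k /and4P[h1 h2 h3 h4]]] := h N; exists (branch n k).
  exact: (fragment_in (erefl b) b0 c0 (fun u => T_gt0 TY u w) h1 h2 h3 h4 a0).
by rewrite size_branch (leq_trans Nn)// leq_addr.
Qed.

(** A good word [u] satisfies the conditions of [fragment_in] on a half-open
    interval of times [q] that starts at a point of [[0, M.+1 / (b * c)]] and
    has length [eta / (b * c)].  With a step less than this length, each such
    interval contains one of finitely many grid points. *)
Lemma grid_hits_often w M :
  (forall N, exists2 n, (N <= n)%N & good_branch T Y b c x M n w) ->
  exists i p : nat, hits_often (i%:R / p.+1%:R) w.
Proof.
move=> good.
pose eta := Num.min (M.+1%:R^-1) (expR (b * ln (1 + a)) - 1).
have eta0 : 0 < eta.
  rewrite lt_min invr_gt0 ltr0n/= subr_gt0 -[ltLHS]expR0 ltr_expR mulr_gt0//.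
  by rewrite ln_gt0// ltrDl.
pose p := Num.truncn (b * c / eta).
have p0 : (0 : R) < p.+1%:R by rewrite ltr0n.
have pe : b * c / p.+1%:R < eta.
  by rewrite ltr_pdivrMr// [eta * _]mulrC -ltr_pdivrMr// truncnS_gt.
pose I := (Num.truncn (M.+1%:R / (b * c) * p.+1%:R : R)).+1.
apply: contrapT => /forallNP none.
have ev i : (i <= I)%N -> exists N, forall n, (N <= n)%N ->
    ~ exists k, in_window (i%:R / p.+1%:R) (branch n k) w.
  move=> _; have /forallNP/(_ p) := none i.
  move=> /existsNP[N hN]; exists N => n Nn hk; apply: hN; by exists n.
have [N hN] := eventually_below ev.
have [n Nn [k /and3P[z0 up cM]]] := good N.
set u := branch n k in z0 up cM.
pose A := (1 - expR (b * zetaw u w) + clockw u w) / (b * c).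
have ez : expR (b * zetaw u w) < 1 by rewrite expR_lt1 pmulr_rlt0.
have A0 : 0 <= A.
  by rewrite divr_ge0 ?(ltW bc0)// addr_ge0 ?(clock_at_ge0 TY)// subr_ge0 ltW.
have AM : A <= M.+1%:R / (b * c).
  rewrite ler_pM2r ?invr_gt0// -natr1.
  by have := expR_ge0 (b * zetaw u w); move: cM; lra.
pose i := (Num.truncn (A * p.+1%:R)).+1.
apply: (hN i n _ Nn); first by rewrite ltnS le_truncn// ler_pM2r.
exists k; rewrite -/u.
have Ai : A < i%:R / p.+1%:R by rewrite ltr_pdivlMr// truncnS_gt.
have iA : i%:R / p.+1%:R <= A + p.+1%:R^-1.
  have -> : i%:R = (Num.truncn (A * p.+1%:R))%:R + 1 :> R by rewrite natr1.
  rewrite ler_pdivrMr// mulrDl mulVf ?gt_eqF// lerD2r.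
  by rewrite truncn_le mulr_ge0.
have bcA : b * c * A = 1 - expR (b * zetaw u w) + clockw u w.
  by rewrite mulrC divfK ?gt_eqF.
have lo : 1 - expR (b * zetaw u w) + clockw u w < b * c * (i%:R / p.+1%:R).
  by rewrite -bcA ltr_pM2l.
have hi : b * c * (i%:R / p.+1%:R) < 1 - expR (b * zetaw u w) + clockw u w + eta.
  rewrite -bcA; apply: (@le_lt_trans _ _ (b * c * (A + p.+1%:R^-1))).
    by rewrite ler_pM2l.
  by rewrite mulrDr ltrD2l.
have [etaM etaa] : eta <= M.+1%:R^-1 /\ eta <= expR (b * ln (1 + a)) - 1.
  by rewrite !ge_min !lexx orbT.
rewrite /in_window /grown_at -/u; move: lo hi ez etaM etaa up.
move: (expR _) (expR (b * ln _)) (expR (b * (_ + _))) (clockw u w) (b * c * _) (M.+1%:R^-1).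
move=> ez X D cl Q e' lo hi ez1 etaM etaa up.
by apply/and4P; split; lra.
Qed.

Lemma fragmentation_core : exists sigma : Omega -> R,
  [/\ measurable_fun setT sigma, forall w, 0 <= sigma w &
  {ae P, forall w, infinite_set
    (fragments_in alpha c x (T^~ w) (Y^~ w) (sigma w) `[1, 1 + a]%classic)}].
Proof.
pose ij (n : nat) : nat * nat := odflt (0, 0)%N (unpickle n).
pose q n : R := (ij n).1%:R / (ij n).2.+1%:R.
have q0 n : 0 <= q n by rewrite divr_ge0.
have [sigma [ms s0 hs]] := measurable_selection q0
  (fun n => measurable_hits_often (q n)).
exists sigma; split => //.
have := @ae_infinitely_many_good _ _ _ _ _ _ TY b c x b0 c0 EL ER.
apply: filterS => w [M /grid_hits_often] [i [p hip]].
have [|j hj ->] := hs w; last exact: hits_often_fragments.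
exists (pickle (i, p)); rewrite /q /ij pickleK//.
Qed.

End random_time.

(** * Regular versions of the data *)

Lemma probability_preimage_id d (E : measurableType d) (R : realType)
    (mu : probability E R) (f : E -> E) (D A : set E) :
  measurable D -> mu D = 1%E -> measurable_fun setT f ->
  (forall y, D y -> f y = y) -> measurable A -> mu (f @^-1` A) = mu A.
Proof.
move=> mD D1 mf fD mA.
have muI B : measurable B -> mu B = mu (B `&` D).
  move=> mB; have DC0 : mu (~` D) = 0%E.
    by rewrite probability_setC// D1 subee.
  have BD0 : mu (B `&` ~` D) = 0%E.
    apply/eqP; rewrite eq_le measure_ge0 andbT -DC0.
    apply: le_measure; rewrite ?inE; last exact: subIsetr.
      by apply: measurableI => //; exact: measurableC.
    exact: measurableC.
  have e : B = (B `&` D) `|` (B `&` ~` D) by rewrite -setIUr setUCr setIT.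
  transitivity (mu (B `&` D) + mu (B `&` ~` D))%E; last by rewrite BD0 adde0.
  rewrite [in LHS]e; apply: measureU; first exact: measurableI.
  - by apply: measurableI => //; exact: measurableC.
  - by rewrite setIACA setICr setI0.
have mfA : measurable (f @^-1` A) by rewrite -[X in measurable X]setTI; exact: mf.
rewrite (muI _ mfA) (muI _ mA); congr (mu _).
by apply/seteqP; split => y [/= Ay Dy]; split => //; move: Ay; rewrite /preimage/= fD.
Qed.

Lemma same_law_integral d (O : measurableType d) d' (E : measurableType d')
    (R : realType) (P : probability O R) (X X' : O -> E) (f : E -> \bar R) :
  measurable_fun setT X -> measurable_fun setT X' -> measurable_fun setT f ->
  (forall A, measurable A -> P (X @^-1` A) = P (X' @^-1` A)) ->
  (\int[P]_w f (X w) = \int[P]_w f (X' w))%E.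
Proof.
move=> mX mX' mf XX'.
pose Z : {RV P >-> E} := HB.pack X (isMeasurableFun.Build _ _ _ _ _ mX).
pose Z' : {RV P >-> E} := HB.pack X' (isMeasurableFun.Build _ _ _ _ _ mX').
have key (h : E -> \bar R) : measurable_fun setT h -> (forall y, 0 <= h y)%E ->
    (\int[P]_w h (X w) = \int[P]_w h (X' w))%E.
  move=> mh h0; transitivity (\int[distribution P Z]_y h y)%E.
    by rewrite ge0_integral_distribution.
  transitivity (\int[distribution P Z']_y h y)%E.
    by apply: eq_measure_integral => A mA _; exact: XX'.
  by rewrite ge0_integral_distribution.
rewrite integralE [RHS]integralE; congr (_ - _)%E.
- transitivity (\int[P]_w (f^\+ (X w)))%E.
    by apply: eq_integral => w _; rewrite !funeposE.
  rewrite (key _ (measurable_funepos mf) (funepos_ge0 f)).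
  by apply: eq_integral => w _; rewrite !funeposE.
- transitivity (\int[P]_w (f^\- (X w)))%E.
    by apply: eq_integral => w _; rewrite !funenegE.
  rewrite (key _ (measurable_funeneg mf) (funeneg_ge0 f)).
  by apply: eq_integral => w _; rewrite !funenegE.
Qed.

Lemma probability_eq1_ae d (O : measurableType d) (R : realType)
    (P : probability O R) (D : set O) :
  measurable D -> P D = 1%E -> {ae P, forall w, D w}.
Proof.
move=> mD D1; exists (~` D); split => //; first exact: measurableC.
by rewrite probability_setC// D1 subee.
Qed.

(** The default values here and in [clip_ratio] are arbitrary points of the two
    ranges; clipping changes the data on a null event only, and keeps the laws
    and the independence. *)
Definition clip_lifetime (R : realType) (t : R) : R := if 0 < t then t else 1.

Definition clip_ratio (R : realType) (y : R) : R :=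
  if 2^-1 <= y < 1 then y else 2^-1.

Lemma measurable_clip_lifetime (R : realType) :
  measurable_fun setT (@clip_lifetime R).
Proof. by apply: measurable_fun_ifT => //; exact: measurable_fun_ltr. Qed.

Lemma measurable_clip_ratio (R : realType) : measurable_fun setT (@clip_ratio R).
Proof.
apply: measurable_fun_ifT => //; apply: measurable_and.
- exact: measurable_fun_ler.
- exact: measurable_fun_ltr.
Qed.

Lemma exponential1_gt0 (R : realType) :
  exponential1 R `]0, +oo[%classic = 1%E.
Proof.
have <- : exponential1 R `[0, +oo[%classic = 1%E.
  by rewrite exponential_tail// oppr0 expR0.
rewrite /exponential1/= /exponential_prob; apply: integral_itv_obnd_cbnd.
by apply: measurable_funTS; apply/measurable_EFinP; exact: measurable_exponential_pdf.
Qed.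

Theorem proposition5p1 (R : realType) (d : measure_display)
    (Omega : measurableType d) (P : probability Omega R)
    (alpha c x : R) (K : probability (measurableTypeR R) R)
    (Y0 : {RV P >-> R}) (T Y : word -> {RV P >-> R}) :
  alpha < 0 ->
  K `[2^-1, 1[%classic = 1%E ->
  ~ same_law K (\d_(2^-1 : measurableTypeR R)) ->
  same_law (distribution P Y0) K ->
  ('E_P[fun w => ln (1 - Y0 w)] + c%:E < 0)%E ->
  (0 < 'E_P[fun w => ln (Y0 w)] + c%:E)%E ->
  (forall u, same_law (distribution P (T u)) (exponential_prob 1)) ->
  (forall u, same_law (distribution P (Y u)) K) ->
  mutually_independent
    (fun i : word + word => match i with inl u => T u | inr u => Y u end) ->
  forall a : R, 0 < a ->
  exists sigma : {RV P >-> R},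
    (forall w, 0 <= sigma w) /\
    {ae P, forall w : Omega,
      infinite_set (fragments_in alpha c x (fun u => T u w) (fun u => Y u w)
        (sigma w) `[1, 1 + a]%classic)}.
Proof.
move=> alpha0 K1 _ lawY0 EL ER lawT lawY indep a a0.
pose T' u w := clip_lifetime (T u w); pose Y' u w := clip_ratio (Y u w).
have mT' u : measurable_fun setT (T' u).
  by apply: measurableT_comp => //; exact: measurable_clip_lifetime.
have mY' u : measurable_fun setT (Y' u).
  by apply: measurableT_comp => //; exact: measurable_clip_ratio.
have mpre (f : R -> R) (A : set R) : measurable_fun setT f -> measurable A ->
    measurable (f @^-1` A).
  by move=> mf mA; rewrite -[X in measurable X]setTI; exact: mf.
have lawT' u (A : set (measurableTypeR R)) : measurable A ->
    P (T' u @^-1` A) = exponential1 R A.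
  move=> mA; transitivity (exponential1 R (@clip_lifetime R @^-1` A)).
    by apply: (lawT u); exact: (mpre _ _ (@measurable_clip_lifetime R)).
  apply: (@probability_preimage_id _ (measurableTypeR R) R (exponential1 R)
    (@clip_lifetime R) `]0, +oo[%classic) => //.
  - exact: exponential1_gt0.
  - exact: measurable_clip_lifetime.
  - by move=> y; rewrite /= in_itv/= andbT /clip_lifetime => ->.
have lawY' u (A : set (measurableTypeR R)) : measurable A ->
    P (Y' u @^-1` A) = K A.
  move=> mA; transitivity (K (@clip_ratio R @^-1` A)).
    by apply: (lawY u); exact: (mpre _ _ (@measurable_clip_ratio R)).
  apply: (@probability_preimage_id _ (measurableTypeR R) R K
    (@clip_ratio R) `[2^-1, 1[%classic) => //.
  - exact: measurable_clip_ratio.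
  - by move=> y; rewrite /= in_itv/= /clip_ratio => ->.
have half1 : 2^-1 < 1 :> R by rewrite invf_lt1// ltr1n.
have TY' : driving_noise P T' Y'.
  split => //.
  - by move=> u w; rewrite /T' /clip_lifetime; case: ifP.
  - by move=> u w; rewrite /Y' /clip_ratio; case: ifPn => [/andP[]|].
  - by move=> u w; rewrite /Y' /clip_ratio; case: ifPn => [/andP[]|].
  - by move=> u A mA; rewrite !lawY'.
  - move=> s A us mA.
    pose A' (j : site) := match j with
      | inl _ => @clip_lifetime R @^-1` A j
      | inr _ => @clip_ratio R @^-1` A j end.
    have mA' j : measurable (A' j).
      case: j => u; apply: mpre => //.
        exact: measurable_clip_lifetime.
      exact: measurable_clip_ratio.
    pose X (j : site) : {RV P >-> R} := match j with inl u => T u | inr u => Y u end.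
    have e j : noise T' Y' j @^-1` A j = X j @^-1` A' j by case: j.
    rewrite (eq_bigr _ (fun j _ => e j)); apply: (etrans (indep s A' us mA')).
    by apply: eq_bigr => j _; rewrite e.
have mlnE : measurable_fun setT (fun y : R => (ln y)%:E).
  by apply/measurable_EFinP; exact: measurable_ln.
have mln1E : measurable_fun setT (fun y : R => (ln (1 - y))%:E).
  apply/measurable_EFinP; apply: measurableT_comp; first exact: measurable_ln.
  exact: measurable_funB.
have law0 (A : set R) : measurable A -> P (Y0 @^-1` A) = P (Y' [::] @^-1` A).
  by move=> mA; rewrite lawY'//; exact: lawY0.
have EL' : (\int[P]_w (ln (1 - Y' [::] w))%:E + c%:E < 0)%E.
  by rewrite -(same_law_integral _ _ mln1E law0)//; move: EL; rewrite unlock.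
have ER' : (0 < \int[P]_w (ln (Y' [::] w))%:E + c%:E)%E.
  by rewrite -(same_law_integral _ _ mlnE law0)//; move: ER; rewrite unlock.
have c0 : 0 < c.
  rewrite -lte_fin; apply: (lt_le_trans ER'); rewrite -[leRHS]add0e; apply: leeD2r.
  rewrite integralE integral0_eq; last first.
    move=> w _; rewrite funeposE; apply/max_idPr; rewrite lee_fin ln_le0//.
    exact/ltW/(Y_lt1 TY').
  by rewrite sub0e oppe_le0; apply: integral_ge0 => w _; exact: funeneg_ge0.
have [sigma [ms s0 hs]] := @fragmentation_core _ _ _ _ _ _ TY' alpha c x a alpha0 c0 a0 EL' ER'.
pose sigmaRV : {RV P >-> R} := HB.pack sigma (isMeasurableFun.Build _ _ _ _ _ ms).
exists sigmaRV; split; first exact: s0.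
have aeT u : {ae P, forall w, T' u w = T u w}.
  have T1 : P (T u @^-1` `]0, +oo[%classic) = 1%E.
    by apply: etrans (exponential1_gt0 R); exact: lawT.
  have mD : measurable (T u @^-1` `]0, +oo[%classic) by exact: measurable_funPTI.
  have := probability_eq1_ae mD T1; apply: filterS => w.
  by rewrite /= in_itv/= andbT /T' /clip_lifetime => ->.
have aeY u : {ae P, forall w, Y' u w = Y u w}.
  have Y1 : P (Y u @^-1` `[2^-1, 1[%classic) = 1%E.
    by apply: etrans K1; exact: lawY.
  have mD : measurable (Y u @^-1` `[2^-1, 1[%classic) by exact: measurable_funPTI.
  have := probability_eq1_ae mD Y1; apply: filterS => w.
  by rewrite /= in_itv/= /Y' /clip_ratio => ->.
pose same (o : option word) w :=
  if o is Some u then T' u w = T u w /\ Y' u w = Y u w else True.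
have aesame o : {ae P, forall w, same o w}.
  case: o => [u|]; last by apply: aeW.
  by move: (aeT u) (aeY u); apply: filterS2 => w.
have := ae_foralln (fun n => aesame (unpickle n)).
move: hs; apply: filterS2 => w hw eqTY.
have {}eqTY u : T' u w = T u w /\ Y' u w = Y u w.
  by have := eqTY (pickle u); rewrite pickleK.
have eT : T'^~ w = (fun u => T u w) by apply/funext => u; have [] := eqTY u.
have eY : Y'^~ w = (fun u => Y u w) by apply/funext => u; have [] := eqTY u.
by rewrite -eT -eY.
Qed.
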